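(* With the parameter choice $I=n^{1/5}(\log\log n)^{4/5}$, the time complexity of the algorithm $\mathcal{A}$ described in the context (which computes the number $S(n)$ of square-free positive integers not exceeding $n$) is $$O\left(n^{2/5}(\log\log n)^{3/5}\right)=\tilde O(n^{2/5})$$ as $n\to\infty$. Here $I=\tilde O(n^{1/5})$.
   Context: $\mu$ is the Möbius function, and $M(x)=\sum_{1\le i\le x}\mu(i)$ is the Mertens function, so $M(x)=M(\lfloor x\rfloor)$. $S(n)$ is the number of positive integers $\le n$ not divisible by the square of any integer greater than one. The notation $\tilde O$ is like $O$ but ignores logarithmic factors. Time is measured as the number of elementary operations, where each arithmetic operation on integers of size polynomial in $n$ and each memory access counts as one operation. The parameter $I$ is understood to be rounded to a positive integer, and $n$ is taken large enough that $I\le\sqrt[3]{n/4}$. Put $x_i=\lfloor\sqrt{n/i}\rfloor$ for $i=1,\dots,I$ and $D=x_I$. Algorithm $\mathcal{A}$, on input $n$ with parameter $I$: (1) Tabulate $\mu(d)$ for $d=1,\dots,D$ by a sieve: initialize all entries to $1$; for each prime $p\le D$ (primes generated by the sieve of Eratosthenes) set to $0$ every entry whose index is divisible by $p^2$ and negate every entry whose index is divisible by $p$. From this compute and store $M(d)$ for $d=1,\dots,D$, and compute $S_1(n)=\sum_{d=1}^{D}\mu(d)\lfloor n/d^2\rfloor$. (2) For $i=I-1,I-2,\dots,1$ in this order, compute and store $M(x_i)$ by the recursion $M(x)=1-\sum_{d\ge2}M(x/d)$ with $x=x_i$. The sum is evaluated by grouping together all $d$ with the same value of $\lfloor x_i/d\rfloor$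 (there are at most $2\sqrt{x_i}$ distinct values). A needed value $M(x_i/d)$ is read from the table of step (1) if $\lfloor x_i/d\rfloor\le D$. Otherwise $\lfloor x_i/d\rfloor=x_{d^2i}$ with $d^2i<I$, and the previously stored value $M(x_{d^2i})$ is used. (3) Compute $S_2(n)=\left(\sum_{i=1}^{I-1}M(x_i)\right)-(I-1)M(x_I)$. (4) Return $S_1(n)+S_2(n)$. *)

(* Defs.v *)
(* MathComp / MathComp-Analysis *)
From HB Require Import structures.
From mathcomp Require Import all_boot all_order all_algebra.
From mathcomp Require Import all_classical all_reals all_analysis.

Set Implicit Arguments.
Unset Strict Implicit.
Unset Printing Implicit Defensive.

Import Order.TTheory GRing.Theory Num.Theory.
Import numFieldNormedType.Exports.

Definition squarefree (m : nat) : bool :=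
  `[< forall d, (1 < d)%N -> ~~ (d ^ 2 %| m)%N >].

Definition nb_squarefree (n : nat) : nat :=
  \sum_(1 <= m < n.+1 | squarefree m) 1.

(* A random access machine, programmed in a while-language whose only data are
   integers held in registers and in arrays.  There is no built-in operation
   beyond the four arithmetic operations on integers; in particular integer
   square roots have to be programmed. *)

Inductive reg :=
  | n_ | I_ | D_ | S1_ | S2_ | S_ | i_ | p_ | k_ | x_ | d_ | v_ | e_ | m_ | s_
  | q_ | lo_ | hi_ | mid_.

Inductive arr := COMP | MU | MERT | MX.

Definition reg_eq_dec : comparable reg.
Proof. by move=> x y; rewrite /decidable; decide equality. Defined.

Definition arr_eq_dec : comparable arr.
Proof. by move=> x y; rewrite /decidable; decide equality. Defined.

HB.instance Definition _ := comparableMixin reg_eq_dec.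
HB.instance Definition _ := comparableMixin arr_eq_dec.

Inductive binop := Add | Sub | Mul | Div.

Inductive expr :=
  | Cst of int
  | Var of reg
  | Get of arr & expr
  | Bin of binop & expr & expr.

Inductive cmp := Le | Lt | Eq.

Inductive test := Test of cmp & expr & expr.

Inductive cmd :=
  | Skip
  | Assign of reg & expr
  | Put (a : arr) (e1 e2 : expr)
  | Seq of cmd & cmd
  | If (b : test) (c1 c2 : cmd)
  | While (b : test) (c : cmd).

Record store := Store { regs : reg -> int; mem : arr -> nat -> int }.

Definition set_reg (s : store) (x : reg) (v : int) : store :=
  Store (fun y => if y == x then v else regs s y) (mem s).

Definition set_mem (s : store) (a : arr) (j : nat) (v : int) : store :=
  Store (regs s)
    (fun b l => if (b == a) && (l == j) then v else mem s b l).

(* The machine handles only integers of absolute value at most W: anything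
   larger, like a division by zero or a negative array index, blocks it. *)
Definition word (W : nat) (v : int) : option int :=
  if (absz v <= W)%N then Some v else None.

Definition arith (op : binop) (v1 v2 : int) : option int :=
  match op with
  | Add => Some (v1 + v2)%R
  | Sub => Some (v1 - v2)%R
  | Mul => Some (v1 * v2)%R
  | Div => if v2 == 0%R then None else Some (v1 %/ v2)%Z
  end.

Fixpoint eval (W : nat) (s : store) (e : expr) : option int :=
  match e with
  | Cst c => word W c
  | Var x => word W (regs s x)
  | Get a e1 =>
      if eval W s e1 is Some (Posz j) then word W (mem s a j) else None
  | Bin op e1 e2 =>
      if eval W s e1 is Some v1 then
        if eval W s e2 is Some v2 then obind (word W) (arith op v1 v2)
        else None
      else None
  end.

Definition eval_test (W : nat) (s : store) (b : test) : option bool :=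
  let: Test c e1 e2 := b in
  if eval W s e1 is Some v1 then
    if eval W s e2 is Some v2 then
      Some match c with
           | Le => (v1 <= v2)%R
           | Lt => (v1 < v2)%R
           | Eq => v1 == v2
           end
    else None
  else None.

(* Every constant, register access, array access, arithmetic operation and
   comparison counts for one elementary operation, and so does every write. *)
Fixpoint cost_expr (e : expr) : nat :=
  match e with
  | Cst _ => 1
  | Var _ => 1
  | Get _ e1 => (cost_expr e1).+1
  | Bin _ e1 e2 => (cost_expr e1 + cost_expr e2).+1
  end.

Definition cost_test (b : test) : nat :=
  let: Test _ e1 e2 := b in (cost_expr e1 + cost_expr e2).+1.

(* exec W c s t s' : with word bound W, started in the store s, the command c
   halts without blocking in the store s', after t elementary operations. *)
Inductive exec (W : nat) : cmd -> store -> nat -> store -> Prop :=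
  | ExecSkip s : exec W Skip s 0 s
  | ExecAssign x e s v : eval W s e = Some v ->
      exec W (Assign x e) s (cost_expr e).+1 (set_reg s x v)
  | ExecPut a e1 e2 s j v :
      eval W s e1 = Some (Posz j) -> eval W s e2 = Some v ->
      exec W (Put a e1 e2) s (cost_expr e1 + cost_expr e2).+1 (set_mem s a j v)
  | ExecSeq c1 c2 s t1 s1 t2 s2 :
      exec W c1 s t1 s1 -> exec W c2 s1 t2 s2 ->
      exec W (Seq c1 c2) s (t1 + t2) s2
  | ExecIfTrue b c1 c2 s t s' :
      eval_test W s b = Some true -> exec W c1 s t s' ->
      exec W (If b c1 c2) s (cost_test b + t) s'
  | ExecIfFalse b c1 c2 s t s' :
      eval_test W s b = Some false -> exec W c2 s t s' ->
      exec W (If b c1 c2) s (cost_test b + t) s'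
  | ExecWhileFalse b c s :
      eval_test W s b = Some false -> exec W (While b c) s (cost_test b) s
  | ExecWhileTrue b c s t1 s1 t2 s2 :
      eval_test W s b = Some true ->
      exec W c s t1 s1 -> exec W (While b c) s1 t2 s2 ->
      exec W (While b c) s (cost_test b + t1 + t2) s2.

Lemma exec_det W c s t s1 t' s2 :
  exec W c s t s1 -> exec W c s t' s2 -> t = t' /\ s1 = s2.
Proof.
move=> H; elim: H t' s2 => {c s t s1}.
- by move=> s t' s2 H; inversion H.
- by move=> x e s v He t' s2 H; inversion H; subst; split; congruence.
- by move=> a e1 e2 s j v H1 H2 t' s2 H; inversion H; subst; split; congruence.
- move=> c1 c2 s t1 s1 t2 s2 _ IH1 _ IH2 t' s' H; inversion H; subst.
  have [? ?] := IH1 _ _ ltac:(eassumption); subst.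
  by have [? ?] := IH2 _ _ ltac:(eassumption); subst.
- move=> b c1 c2 s t s' Hb _ IH t' s2 H; inversion H; subst; last by congruence.
  by have [? ?] := IH _ _ ltac:(eassumption); subst.
- move=> b c1 c2 s t s' Hb _ IH t' s2 H; inversion H; subst; first by congruence.
  by have [? ?] := IH _ _ ltac:(eassumption); subst.
- by move=> b c s Hb t' s2 H; inversion H; subst => //; congruence.
- move=> b c s t1 s1 t2 s2 Hb _ IH1 _ IH2 t' s' H; inversion H; subst.
    by congruence.
  have [? ?] := IH1 _ _ ltac:(eassumption); subst.
  by have [? ?] := IH2 _ _ ltac:(eassumption); subst.
Qed.

Declare Scope expr_scope.
Declare Scope test_scope.
Declare Scope cmd_scope.
Delimit Scope expr_scope with expr.
Delimit Scope test_scope with test.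
Delimit Scope cmd_scope with cmd.
Bind Scope expr_scope with expr.
Bind Scope test_scope with test.
Bind Scope cmd_scope with cmd.

Arguments Put a (e1 e2)%_expr_scope.
Arguments If b%_test_scope (c1 c2)%_cmd_scope.
Arguments While b%_test_scope c%_cmd_scope.

Coercion Var : reg >-> expr.

Notation "0" := (Cst 0%R) : expr_scope.
Notation "1" := (Cst 1%R) : expr_scope.
Notation "2" := (Cst 2%R) : expr_scope.
Notation "e1 + e2" := (Bin Add e1%expr e2%expr) : expr_scope.
Notation "e1 - e2" := (Bin Sub e1%expr e2%expr) : expr_scope.
Notation "e1 * e2" := (Bin Mul e1%expr e2%expr) : expr_scope.
Notation "e1 / e2" := (Bin Div e1%expr e2%expr) : expr_scope.
Notation "a .[ e ]" := (Get a e%expr) : expr_scope.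

Notation "e1 <= e2" := (Test Le e1%expr e2%expr) : test_scope.
Notation "e1 < e2" := (Test Lt e1%expr e2%expr) : test_scope.
Notation "e1 == e2" := (Test Eq e1%expr e2%expr) : test_scope.

Notation "x ::= e" := (Assign x e%expr) (at level 80) : cmd_scope.
Notation "c1 ;; c2" := (Seq c1%cmd c2%cmd)
  (at level 90, right associativity, format "c1 ;; '//' c2") : cmd_scope.

Definition when (b : test) (c : cmd) : cmd := If b c Skip.

(* for x = e1, e1 + 1, ..., e2; the bound e2 is re-evaluated at each turn *)
Definition for_up (x : reg) (e1 e2 : expr) (c : cmd) : cmd :=
  (x ::= e1 ;; While (x <= e2) (c ;; x ::= x + 1))%cmd.

Definition for_down (x : reg) (e1 e2 : expr) (c : cmd) : cmd :=
  (x ::= e1 ;; While (e2 <= x) (c ;; x ::= x - 1))%cmd.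

(* for k = e, 2e, 3e, ..., as long as k <= D *)
Definition for_multiples (e : expr) (c : cmd) : cmd :=
  (k_ ::= e ;; While (k_ <= D_) (c ;; k_ ::= k_ + e))%cmd.

(* x := floor (sqrt e), by bisection *)
Definition isqrt (x : reg) (e : expr) : cmd :=
  (q_ ::= e ;;
   lo_ ::= 0 ;;
   hi_ ::= q_ + 1 ;;
   While (lo_ + 1 < hi_)
     (mid_ ::= (lo_ + hi_) / 2 ;;
      If (mid_ * mid_ <= q_) (lo_ ::= mid_) (hi_ ::= mid_)) ;;
   x ::= lo_)%cmd.

(* COMP.[k] = 0 iff k is prime, for 2 <= k <= D; the multiples of p to be
   crossed out start from 2p. *)
Definition eratosthenes : cmd :=
  (for_up d_ 1 D_ (Put COMP d_ 0) ;;
   for_up p_ 2 D_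
     (when (COMP.[p_] == 0)
        (k_ ::= p_ + p_ ;;
         While (k_ <= D_) (Put COMP k_ 1 ;; k_ ::= k_ + p_))))%cmd.

(* MU.[d] is mu(d) and MERT.[d] is M(d), for 1 <= d <= D. *)
Definition step1 : cmd :=
  (isqrt D_ (n_ / I_) ;;
   eratosthenes ;;
   for_up d_ 1 D_ (Put MU d_ 1) ;;
   for_up p_ 2 D_
     (when (COMP.[p_] == 0)
        (for_multiples (p_ * p_) (Put MU k_ 0) ;;
         for_multiples p_ (Put MU k_ (0 - MU.[k_])))) ;;
   Put MERT 0 0 ;;
   for_up d_ 1 D_ (Put MERT d_ (MERT.[d_ - 1] + MU.[d_])) ;;
   S1_ ::= 0 ;;
   for_up d_ 1 D_ (S1_ ::= S1_ + MU.[d_] * (n_ / (d_ * d_))))%cmd.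

(* MX.[i] is M(x_i), for 1 <= i < I.  In the inner loop, d runs through the
   least elements of the groups {d, ..., e} of indices sharing the same
   quotient v = floor (x_i / d). *)
Definition step2 : cmd :=
  for_down i_ (I_ - 1) 1
    (isqrt x_ (n_ / i_) ;;
     s_ ::= 1 ;;
     d_ ::= 2 ;;
     While (d_ <= x_)
       (v_ ::= x_ / d_ ;;
        e_ ::= x_ / v_ ;;
        If (v_ <= D_)
          (m_ ::= MERT.[v_])
          (m_ ::= MX.[d_ * d_ * i_]) ;;
        s_ ::= s_ - (e_ - d_ + 1) * m_ ;;
        d_ ::= e_ + 1) ;;
     Put MX i_ s_)%cmd.

Definition step3 : cmd :=
  (S2_ ::= 0 ;;
   for_up i_ 1 (I_ - 1) (S2_ ::= S2_ + MX.[i_]) ;;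
   S2_ ::= S2_ - (I_ - 1) * MERT.[D_])%cmd.

Definition algA : cmd :=
  (step1 ;; step2 ;; step3 ;; S_ ::= S1_ + S2_)%cmd.

Definition input (n Ipar : nat) : store :=
  Store (fun x => match x with
                  | n_ => Posz n
                  | I_ => Posz Ipar
                  | _ => 0%R
                  end)
        (fun _ _ => 0%R).

Definition algA_runs (W n Ipar t : nat) (r : int) : Prop :=
  exists2 s, exec W algA (input n Ipar) t s & regs s S_ = r.

Local Open Scope classical_set_scope.
Local Open Scope ring_scope.

Definition loglog (R : realType) (n : nat) : R := ln (ln n%:R).

(* m is r rounded to a positive integer; rounding down, up or to nearest are
   all allowed. *)
Definition rounds_to (R : realType) (r : R) (m : nat) : Prop :=
  (0 < m)%N /\ `|m%:R - r| < 1.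

Definition softO (R : realType) (f g : nat -> R^o) : Prop :=
  exists k : nat, f =O_\oo (fun n => g n * ln n%:R ^+ k : R^o).

(* Main.v *)
From Pilot Require Import Defs.
From Stdlib Require Import PeanoNat.
From mathcomp Require Import all_boot all_order all_algebra.
From mathcomp Require Import all_classical all_reals all_analysis.
From mathcomp Require Import zify ring lra.
Import Order.TTheory GRing.Theory Num.Theory.
Import numFieldNormedType.Exports.
Import Pilot.Defs.
Set Implicit Arguments.
Unset Strict Implicit.

(** Correctness.  The sum of [mu d] over the [d] with [d ^ 2 %| m] is 1 if [m] is
    square-free and 0 otherwise, so the number of square-free integers up to [n]
    is the sum of [mu d * (n %/ d ^ 2)].  The terms with [d <= D] are added
    directly; for [d > D] the weight [n %/ d ^ 2] is below [I] and counts the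
    [i] with [d <= x_i], which leaves the sum of [M(x_i) - M(D)] over [i < I]
    ([nb_squarefree_split]).  The values [M(x_i)] come from the identity
    [sum_mertens], and the quotients of [x_i] that exceed [D] are themselves
    numbers [x_j] with [i < j < I], for which [M] is already known
    ([sqrt_quot_div], [sqrt_quot_gt]).

    Running time.  Executions are analysed by a calculus of preconditions with
    time bounds ([wp]), in which the invariant of a loop carries the time that
    remains ([wp_while]).  For each [k] with [n < 2 ^ k] it yields
    ([algA_correct]) a running time bounded by a constant times
      [D + \sum_(p <= D) D / p + I * k + \sum_(i < I) sqrt x_i],
    where [p] ranges over primes: the sieve tables, the visits of the sieves, the
    bisections that compute the [x_i], and the groups of equal quotients in the
    recursion, of which there are at most [2 * sqrt x_i].  All intermediate
    values are at most [4 * (n + 1) ^ 2], hence fit in words of size [n ^ 4].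

    Balance.  Chebyshev's bound on the primes between [2 ^ j] and [2 ^ j.+1]
    gives [\sum_(p <= D) 1 / p = O(ln (ln n))] ([sum_inv_primes]), so the sieve
    costs [O(sqrt (n / I) * ln (ln n))].  Since [x_i ^ 2 * i <= n], the recursions
    cost [n ^ (1 / 4) * \sum_(i < I) i ^ (- 1 / 4) = O(n ^ (1 / 4) * I ^ (3 / 4))]
    ([sum_inv_root4]).  Both are of the claimed order for the prescribed [I], and
    [I * k] is of smaller order. *)

(** * Moebius and Mertens functions, and the count of square-free integers *)

Definition mu_factor (q d : nat) : int :=
  if q ^ 2 %| d then 0%R else if q %| d then (-1)%R else 1%R.

(** The Moebius function is written as a product over primes because the
    partial product [mu_upto p d] is the entry that the sieve has in its table
    for [d] once the primes below [p] have been treated. *)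
Definition mu_upto (p d : nat) : int :=
  (\prod_(0 <= q < p | prime q) mu_factor q d)%R.

Definition mu (d : nat) : int := mu_upto d.+1 d.

Definition mertens (x : nat) : int := (\sum_(1 <= d < x.+1) mu d)%R.

Lemma mu_uptoS p d :
  mu_upto p.+1 d = (mu_upto p d * (if prime p then mu_factor p d else 1))%R.
Proof.
by rewrite /mu_upto big_mkcond big_nat_recr //= -big_mkcond.
Qed.

Lemma mu_factor1 q d : ~~ (q %| d) -> mu_factor q d = 1%R.
Proof.
move=> qd; rewrite /mu_factor (negPf qd); case: ifP => // q2d.
by case/negP: qd; apply: dvdn_trans q2d; rewrite expnS dvdn_mulr.
Qed.

Lemma mu_uptoE p d : 0 < d -> d < p -> mu_upto p d = mu d.
Proof.
move=> d0 dp; rewrite /mu /mu_upto (@big_cat_nat _ _ _ d.+1) //=.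
rewrite [X in (_ * X)%R]big_nat_cond [X in (_ * X)%R]big1 ?mulr1 //.
move=> q /andP[/andP[dq _] _]; apply: mu_factor1.
by apply/negP => /(dvdn_leq d0); rewrite leqNgt dq.
Qed.

Lemma normr_mu_factor q d : (`|mu_factor q d| <= 1)%R.
Proof. by rewrite /mu_factor; case: ifP => // _; case: ifP. Qed.

Lemma normr_mu_upto p d : (`|mu_upto p d| <= 1)%R.
Proof.
elim: p => [|p IH]; first by rewrite /mu_upto big_geq.
rewrite mu_uptoS normrM; case: ifP => _; last by rewrite normr1 mulr1.
by rewrite mulr_ile1 ?normr_mu_factor.
Qed.

Lemma normr_mu d : (`|mu d| <= 1)%R.
Proof. exact: normr_mu_upto. Qed.

Lemma mertensS x : mertens x.+1 = (mertens x + mu x.+1)%R.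
Proof. by rewrite /mertens big_nat_recr. Qed.

Lemma mertens0 : mertens 0 = 0%R.
Proof. by rewrite /mertens big_geq. Qed.

Lemma absz_mertens x : absz (mertens x) <= x.
Proof.
elim: x => [|x IH]; first by rewrite mertens0.
rewrite mertensS; have := normr_mu x.+1; lia.
Qed.

Lemma prime_dvdn_mul p q d : prime p -> prime q -> p != q ->
  (q %| p * d) = (q %| d).
Proof.
by move=> pp pq npq; rewrite Gauss_dvdr // prime_coprime // dvdn_prime2 // eq_sym.
Qed.

Lemma mu_mul p d : prime p -> 0 < d -> ~~ (p %| d) -> mu (p * d) = (- mu d)%R.
Proof.
move=> pp d0 pd.
have p0 := prime_gt0 pp.
rewrite -(@mu_uptoE (p * d).+1 d) //; last by rewrite ltnS leq_pmull.
rewrite /mu /mu_upto big_mkcond [in RHS]big_mkcond /=.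
have pin : p \in index_iota 0 (p * d).+1.
  by rewrite mem_index_iota /= ltnS leq_pmulr.
rewrite !(bigD1_seq p) ?iota_uniq //= pp.
rewrite (mu_factor1 pd) mul1r -mulN1r; congr (_ * _)%R.
  by rewrite /mu_factor expnS expn1 dvdn_pmul2l // (negPf pd) dvdn_mulr.
apply: eq_bigr => q nqp; case: ifP => // pq.
have npq : p != q by rewrite eq_sym.
have cop : coprime (q ^ 2) p by rewrite coprimeXl // prime_coprime // dvdn_prime2.
by rewrite /mu_factor (Gauss_dvdr _ cop) prime_dvdn_mul.
Qed.

Lemma mu_square_dvd p d : prime p -> 0 < d -> p ^ 2 %| d -> mu d = 0%R.
Proof.
move=> pp d0 p2d; rewrite /mu /mu_upto big_mkcond.
rewrite (bigD1_seq p) ?iota_uniq //=; last first.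
  rewrite mem_index_iota /= ltnS; apply: dvdn_leq => //.
  by apply: dvdn_trans p2d; rewrite expnS dvdn_mulr.
by rewrite pp /mu_factor p2d mul0r.
Qed.

(** The involution of the positive integers that inserts or removes the prime
    [p]; it has to fix the multiples of [p ^ 2], where [mu] vanishes anyway. *)
Definition toggle p d :=
  if p ^ 2 %| d then d else if p %| d then d %/ p else p * d.

Lemma toggle_dvd p d m : prime p -> p %| m -> d %| m -> toggle p d %| m.
Proof.
move=> pp pm dm; rewrite /toggle; case: ifP => // _; case: ifPn => [pd|npd].
  by apply: dvdn_trans dm; rewrite -{2}(divnK pd) dvdn_mulr.
by rewrite Gauss_dvd ?pm // prime_coprime.
Qed.

Lemma toggleK p : prime p -> involutive (toggle p).
Proof.
move=> pp d; have p0 := prime_gt0 pp; rewrite /toggle.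
have [p2d|np2d] := boolP (p ^ 2 %| d); first by rewrite p2d.
have [/dvdnP[e de]|npd] := boolP (p %| d).
  move: np2d; rewrite de mulnK // expnS expn1 dvdn_pmul2r // => npe.
  have /negPf-> : ~~ (p * p %| e) by apply: contra npe => /(dvdn_trans _)->; rewrite ?dvdn_mulr.
  by rewrite (negPf npe) mulnC.
by rewrite expnS expn1 dvdn_pmul2l // (negPf npd) dvdn_mulr // mulKn.
Qed.

Lemma mu_toggle p d : prime p -> 0 < d -> mu (toggle p d) = (- mu d)%R.
Proof.
move=> pp d0; have p0 := prime_gt0 pp; rewrite /toggle.
have [p2d|np2d] := boolP (p ^ 2 %| d); first by rewrite (mu_square_dvd pp).
have [/dvdnP[e de]|npd] := boolP (p %| d); last exact: mu_mul.
move: np2d d0; rewrite de mulnK // expnS expn1 dvdn_pmul2r // => npe.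
by rewrite muln_gt0 => /andP[e0 _]; rewrite mulnC mu_mul ?opprK.
Qed.

(** If a prime [p] divides [m], then [toggle p] permutes the divisors of [m] and
    changes the sign of [mu], so the sum is its own opposite.  The bound [N] is
    free because the lemma is used inside double sums with a common range. *)
Lemma sum_mu_dvd N m : 0 < m -> m < N ->
  (\sum_(1 <= d < N | (d %| m)%N) mu d = (m == 1%N)%:R :> int)%R.
Proof.
move=> m0 mN; have [->|m1] := eqVneq m 1.
  have N1 : 1 < N by case: m m0 mN => // m _; lia.
  rewrite big_mkcond big_ltn // big_nat_cond big1 => [|d].
    by rewrite /mu /mu_upto big_mkcond big_nat_recl // big_nat1 /= addr0.
  by rewrite dvdn1 => /andP[/andP[d1 _] _]; case: eqP => // de; rewrite de in d1.
pose p := pdiv m; have pp : prime p by rewrite pdiv_prime // ltn_neqAle eq_sym m1.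
have pm : p %| m := pdiv_dvd m.
have d_gt0 d : d %| m -> 0 < d by move=> dm; rewrite (dvdn_gt0 m0).
have d_ltN d : d %| m -> d < N by move=> /(dvdn_leq m0) dm; apply: leq_ltn_trans mN.
rewrite big_geq_mkord (eq_bigl (fun d : 'I_N => d %| m)); last first.
  by move=> d /=; rewrite andbC; case: (boolP (d %| m)); rewrite ?andbF // => /d_gt0 ->.
set s := (\sum_(_ < _ | _) _)%R.
suff : s = (- s)%R by lia.
(* [insubd] only makes [toggle p] total on ['I_N]; it acts on divisors of [m]. *)
pose h (d : 'I_N) : 'I_N := insubd d (toggle p d).
have hE (d : 'I_N) : d %| m -> h d = toggle p d :> nat.
  by move=> dm; rewrite val_insubd d_ltN // toggle_dvd.
have hK (d : 'I_N) : d %| m -> h (h d) = d.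
  by move=> dm; apply: val_inj; rewrite /= hE hE // ?toggleK // toggle_dvd.
rewrite {1}/s (reindex_onto h h) => [|d /hK//].
rewrite -sumrN; apply: eq_big => [d|d /andP[hdm /eqP hd]].
  apply/andP/idP => [[hdm /eqP hd]|dm]; last by rewrite hK // hE // toggle_dvd.
  by rewrite -hd hE // toggle_dvd.
have dm : d %| m by rewrite -hd hE // toggle_dvd.
by rewrite hE // mu_toggle // d_gt0.
Qed.

(** Double counting of the pairs [(d, m)] with [d %| m] and [m <= x], weighted
    by [mu d]; only [m = 1] survives. *)
Lemma sum_mu_divn x :
  (\sum_(1 <= d < x.+1) mu d *+ (x %/ d)%N = (0 < x)%N%:R :> int)%R.
Proof.
transitivity (\sum_(1 <= m < x.+1) \sum_(1 <= d < x.+1 | (d %| m)%N) mu d)%R.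
  under [RHS]eq_bigr do rewrite big_mkcond.
  rewrite exchange_big /=; apply: eq_bigr => d _; rewrite divn_count_dvd.
  by rewrite -(sumrMnr (mu d)); apply: eq_bigr => m _; case: (d %| m).
rewrite (@eq_big_nat _ _ _ _ _ _ (fun m => (m == 1%N)%:R)%R) => [|m /andP[m0 mx]]; last first.
  exact: sum_mu_dvd.
case: x => [|x]; first by rewrite big_geq.
rewrite big_ltn // big_nat_cond big1 ?addr0 // => m.
by rewrite andbT => /andP[m1 _]; case: eqP => // m_eq; rewrite m_eq in m1.
Qed.

(** The recursion [M(x) = 1 - \sum_(d >= 2) M(x/d)] behind the second step:
    the left-hand side is the sum of [mu k] over the pairs [(d, k)] with
    [d * k <= x], and so is the sum of [sum_mu_divn]. *)
Lemma sum_mertens x : 0 < x -> (\sum_(1 <= d < x.+1) mertens (x %/ d)%N = 1)%R.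
Proof.
move=> x0; transitivity (\sum_(1 <= d < x.+1) mu d *+ (x %/ d)%N)%R; last first.
  by rewrite sum_mu_divn x0.
rewrite (eq_bigr (fun d => \sum_(1 <= k < x.+1 | (k <= x %/ d)%N) mu k))%R; last first.
  by move=> d _; rewrite /mertens (@big_nat_widen _ _ _ _ _ x.+1) ?ltnS ?leq_div.
under eq_bigr do rewrite big_mkcond.
rewrite exchange_big /=.
apply: eq_big_nat => k /andP[k0 kx].
rewrite big_nat_cond.
under eq_bigr => d /andP[/andP[d0 _] _] do rewrite leq_divRL // mulnC -leq_divRL //.
rewrite -big_nat_cond -big_mkcond.
transitivity (\sum_(1 <= d < (x %/ k).+1) mu k)%R.
  by rewrite [RHS](@big_nat_widen _ _ _ _ _ x.+1) ?ltnS ?leq_div.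
by rewrite sumr_const_nat subn1.
Qed.

(** This Galois connection is all that is ever needed of the integer square
    root: together with [leq_divRL] it turns every statement about roots of
    quotients into an inequality between products. *)
Lemma leq_sqrt r m : (r <= Nat.sqrt m) = (r * r <= m).
Proof. by apply/ssrnat.leP/ssrnat.leP => H; apply/Nat.sqrt_le_square. Qed.

(** Take for [s] the largest integer whose square divides [m].  If [d ^ 2] also
    divides [m], so does [lcmn d s ^ 2], and maximality forces [d %| s].  Thus
    sums over [d ^ 2 %| m] become sums over the divisors of [s]. *)
Lemma square_kernel m : 0 < m ->
  exists2 s, 0 < s & forall d, (d ^ 2 %| m) = (d %| s).
Proof.
move=> m0.
have ex : exists s, s ^ 2 %| m by exists 1.
have ub s : s ^ 2 %| m -> s <= m.
  by move=> /(dvdn_leq m0); apply: leq_trans; case: s => // s; rewrite -mulnn leq_pmull.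
case: (ex_maxnP ex ub) => s sm smax.
have s0 : 0 < s by apply: smax.
exists s => // d; apply/idP/idP => [dm|]; last first.
  by move=> ds; apply: dvdn_trans sm; rewrite dvdn_exp2r.
have d0 : 0 < d by case: d dm => //; rewrite exp0n // dvd0n => /eqP m_eq; rewrite m_eq in m0.
suff lm : lcmn d s ^ 2 %| m.
  have /eqP <- : lcmn d s == s; last exact: dvdn_lcml.
  by rewrite eqn_leq smax //= dvdn_leq ?dvdn_lcmr // lcmn_gt0 d0.
set g := gcdn d s; have g0 : 0 < g by rewrite gcdn_gt0 d0.
have [d' de] : exists d', d = d' * g by apply/dvdnP/dvdn_gcdl.
have [s' se] : exists s', s = s' * g by apply/dvdnP/dvdn_gcdr.
have cop : coprime d' s'.
  by rewrite /coprime -(eqn_pmul2r g0) muln_gcdl -de -se mul1n.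
have -> : lcmn d s = d' * s' * g.
  by rewrite /lcmn -/g {1}de mulnAC mulnK // se mulnA.
move: dm sm; rewrite de se !expnMn => /dvdnP[c mc].
rewrite mc (mulnA c) !dvdn_pmul2r ?expn_gt0 ?g0 // => s'c.
have cop2 : coprime (d' ^ 2) (s' ^ 2) by rewrite coprimeXl // coprimeXr.
by rewrite (Gauss_dvd _ cop2) dvdn_mull.
Qed.

Lemma squarefreeE m s : 0 < m -> 0 < s -> (forall d, (d ^ 2 %| m) = (d %| s)) ->
  squarefree m = (s == 1).
Proof.
move=> m0 s0 ds; apply/asboolP/eqP => [sf|s1 d d1].
  by apply/eqP; rewrite eqn_leq s0 andbT leqNgt; apply/negP => /sf; rewrite ds dvdnn.
by rewrite ds s1 dvdn1 neq_ltn d1 orbT.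
Qed.

(** By [square_kernel] and [sum_mu_dvd], the sum of [mu d] over [d ^ 2 %| m] is
    the indicator of square-freeness of [m]; sum it over [m <= n]. *)
Lemma nb_squarefreeE n N : n < N ^ 2 ->
  (\sum_(1 <= d < N) mu d *+ (n %/ (d * d))%N = Posz (nb_squarefree n))%R.
Proof.
move=> nN.
transitivity (\sum_(1 <= m < n.+1) \sum_(1 <= d < N | (d ^ 2 %| m)%N) mu d)%R.
  under [RHS]eq_bigr do rewrite big_mkcond.
  rewrite exchange_big /=; apply: eq_bigr => d _.
  rewrite mulnn divn_count_dvd -(sumrMnr (mu d)).
  by apply: eq_bigr => m _; case: (_ %| _).
rewrite /nb_squarefree (big_morph Posz PoszD (erefl 0%R)) [RHS]big_mkcond.
apply: eq_big_nat => m /andP[m0 mn].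
have [s s0 sE] := square_kernel m0.
rewrite (squarefreeE m0 s0 sE) (eq_bigl _ _ sE) sum_mu_dvd //; first by case: eqP.
rewrite -ltn_sqr (leq_ltn_trans _ nN) //; apply: leq_trans (mn : m <= n).
by rewrite dvdn_leq // sE.
Qed.

(** The numbers [x_i] at which the algorithm evaluates the Mertens function. *)
Definition sqrt_quot n i := Nat.sqrt (n %/ i).

(** Dividing [x_i] by [d] stays inside the family, because [r * d <= x_i] means
    [r * r * (d * d * i) <= n]. *)
Lemma sqrt_quot_div n i d : 0 < i -> 0 < d -> sqrt_quot n i %/ d = sqrt_quot n (d * d * i).
Proof.
move=> i0 d0; apply/eqP; rewrite eqn_leq /sqrt_quot.
have E r : (r <= Nat.sqrt (n %/ i) %/ d) = (r <= Nat.sqrt (n %/ (d * d * i))).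
  rewrite leq_divRL // !leq_sqrt !leq_divRL ?muln_gt0 ?d0 //.
  by congr (_ <= _); ring.
by rewrite -E leqnn E leqnn.
Qed.

Lemma leq_sqrt_quot n i j : 0 < i -> i <= j -> sqrt_quot n j <= sqrt_quot n i.
Proof.
move=> i0 ij; rewrite /sqrt_quot leq_sqrt (leq_trans _ (leq_div2l n i0 ij)) //.
by rewrite -leq_sqrt.
Qed.

(** With [j = I] this says that a value missing from the table of small
    arguments is [M(x_(d * d * i))] with an index below [I]. *)
Lemma sqrt_quot_gt n i j d : 0 < i -> 0 < d -> 0 < j ->
  sqrt_quot n j < sqrt_quot n i %/ d -> d * d * i < j.
Proof.
move=> i0 d0 j0; rewrite sqrt_quot_div // ltnNge => /negP h; rewrite ltnNge; apply/negP => jle.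
by apply: h; apply: leq_sqrt_quot.
Qed.

(** For [d] beyond [D = x_I] the weight [n %/ (d * d)] is smaller than [I], and
    it is the number of indices [i < I] with [d <= x_i].  Exchanging the sums
    leaves, for each [i], the sum of [mu] over the interval from [D + 1] to
    [x_i]. *)
Lemma nb_squarefree_split n I : 0 < I ->
  (Posz (nb_squarefree n) =
   \sum_(1 <= d < (sqrt_quot n I).+1) mu d *+ (n %/ (d * d))%N
   + ((\sum_(1 <= i < I) mertens (sqrt_quot n i)) - mertens (sqrt_quot n I) *+ I.-1))%R.
Proof.
move=> I0; set D := sqrt_quot n I; set N := (sqrt_quot n 1).+1.
have DN : D < N by rewrite ltnS leq_sqrt_quot.
rewrite -(@nb_squarefreeE n N); last first.
  by rewrite ltnNge -mulnn -[X in _ <= X](divn1 n) -leq_sqrt ltnn.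
rewrite (@big_cat_nat _ _ _ D.+1) //=; congr (_ + _)%R.
transitivity (\sum_(1 <= i < I) \sum_(D.+1 <= d < N | (d <= sqrt_quot n i)%N) mu d)%R; last first.
  rewrite -[I.-1]subn1 -sumr_const_nat -sumrB.
  apply: eq_big_nat => i /andP[i0 iI].
  have Dx : D <= sqrt_quot n i by apply: leq_sqrt_quot => //; apply: ltnW.
  rewrite /mertens (@big_cat_nat _ _ _ D.+1 1 (sqrt_quot n i).+1) //= [RHS]addrC addKr.
  by rewrite (@big_nat_widen _ _ _ _ (sqrt_quot n i).+1 N) // ltnS leq_sqrt_quot.
under [RHS]eq_bigr do rewrite big_mkcond.
rewrite exchange_big /=.
apply: eq_big_nat => d /andP[Dd dN].
have d0 : 0 < d by apply: leq_trans Dd.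
have dd0 : 0 < d * d by rewrite muln_gt0 d0.
have dI : n %/ (d * d) < I.
  by rewrite ltn_divLR // ltnNge mulnC -leq_divRL // -leq_sqrt -ltnNge.
transitivity (\sum_(1 <= i < (n %/ (d * d)).+1) mu d)%R.
  by rewrite sumr_const_nat subn1.
rewrite [LHS](@big_nat_widen _ _ _ _ _ I) // [LHS]big_mkcond.
apply: eq_big_nat => i /andP[i0 _] /=.
by rewrite ltnS leq_divRL // leq_sqrt leq_divRL // mulnC.
Qed.

(** * Sums over primes *)

Lemma prime_dvd_fact p m : prime p -> m < p -> ~~ (p %| m`!).
Proof.
move=> pp; elim: m => [|m IH] mp; first by rewrite Euclid_dvd1.
by rewrite factS Euclid_dvdM // negb_or IH ?(ltnW mp) // andbT gtnNdvd.
Qed.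

Lemma prod_primes_dvd a b N :
  (forall p, a <= p < b -> prime p -> p %| N) ->
  \prod_(a <= p < b | prime p) p %| N.
Proof.
elim: b => [|b IH] dvdN; first by rewrite big_geq // dvd1n.
have [ab|ba] := leqP a b; last by rewrite big_geq // dvd1n.
have dvd_prod : \prod_(a <= p < b | prime p) p %| N.
  by apply: IH => p /andP[ap pb]; apply: dvdN; rewrite ap ltnW.
rewrite big_mkcond big_nat_recr //= -big_mkcond /=.
case: ifP => pb; last by rewrite muln1.
rewrite Gauss_dvd ?dvd_prod ?dvdN ?ab ?ltnSn // coprime_sym prime_coprime //.
rewrite Euclid_dvd_prod // big_has_cond; apply/hasPn => q.
rewrite mem_index_iota => /andP[_ qb]; apply/negP => /andP[pq].
by rewrite dvdn_prime2 // => /eqP bq; rewrite bq ltnn in qb.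
Qed.

Lemma bin_leq_expn n m : 'C(n, m) <= 2 ^ n.
Proof.
have [mn|nm] := leqP m n; last by rewrite bin_small.
rewrite -[2]/(1 + 1) expnDn (bigD1 (Ordinal (mn : m < n.+1))) //=.
by rewrite !exp1n !muln1 leq_addr.
Qed.

(** Chebyshev's argument: a prime between [m] and [2 * m] divides [(2 * m)`!] but
    not [m`!], hence divides the central binomial coefficient. *)
Lemma prod_primes_leq m : \prod_(m.+1 <= p < (2 * m).+1 | prime p) p <= 2 ^ (2 * m).
Proof.
apply: leq_trans (bin_leq_expn (2 * m) m).
have le2 : m <= 2 * m by rewrite leq_pmull.
apply: dvdn_leq; first by rewrite bin_gt0.
apply: prod_primes_dvd => p /andP[mp pm] pp.
have : p %| (2 * m)`! by rewrite dvdn_fact // prime_gt0.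
rewrite -(bin_fact le2) mul2n -addnn addnK !Euclid_dvdM //.
by rewrite (negPf (prime_dvd_fact pp mp)) !orbF.
Qed.

Definition primes_in_block j := \sum_((2 ^ j).+1 <= p < (2 ^ j.+1).+1 | prime p) 1.

(** Each of these primes exceeds [2 ^ j], so their product exceeds
    [2 ^ (j * primes_in_block j)]. *)
Lemma primes_in_block_leq j : j * primes_in_block j <= 2 ^ j.+1.
Proof.
rewrite -(@leq_exp2l 2) // /primes_in_block expnM.
have := prod_primes_leq (2 ^ j); rewrite -expnS; apply: leq_trans.
rewrite expn_sum big_nat_cond [X in _ <= X]big_nat_cond.
by apply: leq_prod => p /andP[/andP[jp _] _]; rewrite expn1 ltnW.
Qed.

(** The number of pairs of a prime and one of its multiples up to [D], which is
    the order of magnitude of the work of a sieve. *)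
Definition prime_quotients D := \sum_(2 <= p < D.+1 | prime p) D %/ p.

Section InversePrimes.
Context (R : realType).
Local Open Scope ring_scope.

Lemma harmonic_le_ln m : \sum_(1 <= j < m.+2) j%:R^-1 <= 1 + ln m.+1%:R :> R.
Proof.
elim: m => [|m IH]; first by rewrite big_nat1 invr1 ln1 addr0.
rewrite big_nat_recr //=; apply: le_trans (lerD IH (lexx _)) _.
rewrite -addrA lerD2l.
have m2 : 0 < m.+2%:R :> R by rewrite ltr0n.
have := @le_ln1Dx R (- m.+2%:R^-1).
have -> : 1 + - m.+2%:R^-1 = m.+1%:R / m.+2%:R :> R.
  by rewrite -(natr1 m.+1) in m2 *; apply: (mulIf (lt0r_neq0 m2));
     rewrite mulrDl mulNr mulVf ?mulfVK ?lt0r_neq0 // mul1r addrK.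
rewrite ln_div ?posrE ?ltr0n // => H.
have : ln m.+1%:R - ln m.+2%:R <= - m.+2%:R^-1 :> R.
  by apply: H; rewrite ltrN2 invf_lt1 // ltr1n.
by move: (ln m.+1%:R) (ln m.+2%:R) (m.+2%:R^-1) => u v w {}H; lra.
Qed.

(** The upper half of Mertens' theorem [\sum_(p <= x) 1 / p = ln (ln x) + O(1)],
    up to a constant factor: the primes between [2 ^ j] and [2 ^ j.+1] contribute
    at most [2 / j] by [primes_in_block_leq], and the harmonic sum of the
    [2 / j] is at most [2 + 2 * ln K].  The prime 2 contributes the remaining
    half. *)
Lemma sum_inv_primes K : (0 < K)%N ->
  \sum_(2 <= p < (2 ^ K).+1 | prime p) p%:R^-1 <= 5 / 2 + 2 * ln K%:R :> R.
Proof.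
case: K => // K _.
apply: (@le_trans _ _ (2^-1 + 2 * \sum_(1 <= j < K.+1) j%:R^-1)); last first.
  case: K => [|K]; first by rewrite big_geq // ln1; lra.
  have := harmonic_le_ln K.
  have : ln K.+1%:R <= ln K.+2%:R :> R by rewrite ler_ln ?posrE ?ltr0n // ler_nat.
  lra.
elim: K => [|K IH].
  rewrite expn1 big_mkcond big_nat1 /= [X in _ * X]big_geq //; lra.
have le2 : (2 <= (2 ^ K.+1).+1)%N by rewrite ltnS expn_gt0.
rewrite (@big_cat_nat _ _ _ (2 ^ K.+1).+1) //=; last by rewrite ltnS leq_exp2l.
rewrite [X in _ <= _ + _ * X]big_nat_recr //= mulrDr addrA; apply: lerD IH _.
have K0 : 0 < K.+1%:R :> R by rewrite ltr0n.
have P0 : 0 < (2 ^ K.+1)%:R :> R by rewrite ltr0n expn_gt0.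
apply: (@le_trans _ _ ((primes_in_block K.+1)%:R / (2 ^ K.+1)%:R)).
  rewrite /primes_in_block natr_sum mulr_suml big_nat_cond [X in _ <= X]big_nat_cond.
  apply: ler_sum => p /andP[/andP[Kp _] _]; rewrite mul1r lef_pV2 ?posrE ?ltr0n //.
    by rewrite ler_nat ltnW.
  by apply: leq_ltn_trans Kp.
rewrite ler_pdivrMr // mulrAC ler_pdivlMr // mulrC -natrM -natrM ler_nat -expnS.
exact: primes_in_block_leq.
Qed.

Lemma prime_quotients_le D K : (0 < K)%N -> (D < 2 ^ K)%N ->
  (prime_quotients D)%:R <= D%:R * (5 / 2 + 2 * ln K%:R) :> R.
Proof.
move=> K0 DK; apply: le_trans (ler_wpM2l (ler0n _ _) (sum_inv_primes K0)).
rewrite /prime_quotients natr_sum mulr_sumr.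
have [D0|D0] := posnP D.
  by rewrite D0 big_geq // sumr_ge0 // => p _; rewrite mul0r.
rewrite [X in _ <= X](@big_cat_nat _ _ _ D.+1) //=; last by rewrite ltnS ltnW.
rewrite -[X in X <= _]addr0; apply: lerD; last first.
  by apply: sumr_ge0 => p _; rewrite divr_ge0.
rewrite big_nat_cond [X in _ <= X]big_nat_cond.
apply: ler_sum => p /andP[/andP[p2 _] _].
have p0 : 0 < p%:R :> R by rewrite ltr0n ltnW.
by rewrite ler_pdivlMr // -natrM ler_nat leq_divM.
Qed.

End InversePrimes.

(** * Reasoning about timed executions *)

Fixpoint writes_reg (c : cmd) (y : reg) : bool :=
  match c with
  | Assign x _ => y == x
  | Seq c1 c2 | If _ c1 c2 => writes_reg c1 y || writes_reg c2 y
  | While _ c1 => writes_reg c1 y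
  | _ => false
  end.

Fixpoint writes_arr (c : cmd) (a : arr) : bool :=
  match c with
  | Put b _ _ => a == b
  | Seq c1 c2 | If _ c1 c2 => writes_arr c1 a || writes_arr c2 a
  | While _ c1 => writes_arr c1 a
  | _ => false
  end.

(** What a command cannot change is read off its syntax.  Since every rule below
    provides the frame of the commands it runs, specifications have to mention
    only the registers and arrays that matter. *)
Definition frame (c : cmd) (s s' : store) : Prop :=
  (forall y, ~~ writes_reg c y -> regs s' y = regs s y) /\
  (forall a, ~~ writes_arr c a -> mem s' a = mem s a).

Lemma frame_refl c s : frame c s s. Proof. by []. Qed.

Lemma frame_trans c s1 s2 s3 : frame c s1 s2 -> frame c s2 s3 -> frame c s1 s3.
Proof.
move=> [r1 m1] [r2 m2]; split=> y wy; first by rewrite r2 // r1.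
by rewrite m2 // m1.
Qed.

Lemma exec_frame W c s t s' : exec W c s t s' -> frame c s s'.
Proof.
elim=> {c s t s'}.
- by [].
- by move=> x e s v _; split=> //= y /negPf->.
- move=> a e1 e2 s j v _ _; split=> //= b /negPf nb.
  by apply/boolp.funext => l; rewrite nb.
- move=> c1 c2 s t1 s1 t2 s2 _ [r1 m1] _ [r2 m2]; split=> y /=; rewrite negb_or.
    by move=> /andP[w1 w2]; rewrite r2 // r1.
  by move=> /andP[w1 w2]; rewrite m2 // m1.
- move=> b c1 c2 s t s' _ _ [r m]; split=> y /=; rewrite negb_or => /andP[w1 w2].
    exact: r.
  exact: m.
- move=> b c1 c2 s t s' _ _ [r m]; split=> y /=; rewrite negb_or => /andP[w1 w2].
    exact: r.
  exact: m.
- by [].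
- by move=> b c s t1 s1 t2 s2 _ _ f1 _ f2; apply: frame_trans f1 f2.
Qed.

Section Eval.
Context (W : nat) (s : store).

Lemma ev_cst c : absz c <= W -> eval W s (Cst c) = Some c.
Proof. by rewrite /= /word => ->. Qed.

Lemma ev_var (x : reg) v : regs s x = v -> absz v <= W -> eval W s x = Some v.
Proof. by rewrite /= /word => -> ->. Qed.

Lemma ev_get a e j v : eval W s e = Some (Posz j) -> mem s a j = v ->
  absz v <= W -> eval W s (Get a e) = Some v.
Proof. by rewrite /= /word => -> -> ->. Qed.

Lemma ev_bin op e1 e2 v1 v2 v : eval W s e1 = Some v1 -> eval W s e2 = Some v2 ->
  arith op v1 v2 = Some v -> absz v <= W -> eval W s (Bin op e1 e2) = Some v.
Proof. by rewrite /= => -> -> -> /=; rewrite /word => ->. Qed.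

Lemma ev_add e1 e2 (a b : nat) : eval W s e1 = Some (Posz a) ->
  eval W s e2 = Some (Posz b) -> a + b <= W ->
  eval W s (Bin Add e1 e2) = Some (Posz (a + b)).
Proof. by move=> h1 h2 ab; apply: ev_bin h1 h2 _ _ => //=; rewrite PoszD. Qed.

Lemma ev_sub e1 e2 (a b : nat) : eval W s e1 = Some (Posz a) ->
  eval W s e2 = Some (Posz b) -> b <= a -> a <= W ->
  eval W s (Bin Sub e1 e2) = Some (Posz (a - b)).
Proof.
move=> h1 h2 ba aW; apply: ev_bin h1 h2 _ _ => /=; first by rewrite subzn.
by rewrite (leq_trans _ aW) ?leq_subr.
Qed.

Lemma ev_mul e1 e2 (a b : nat) : eval W s e1 = Some (Posz a) ->
  eval W s e2 = Some (Posz b) -> a * b <= W ->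
  eval W s (Bin Mul e1 e2) = Some (Posz (a * b)).
Proof. by move=> h1 h2 ab; apply: ev_bin h1 h2 _ _ => //=; rewrite PoszM. Qed.

Lemma ev_div e1 e2 (a b : nat) : eval W s e1 = Some (Posz a) ->
  eval W s e2 = Some (Posz b) -> 0 < b -> a <= W ->
  eval W s (Bin Div e1 e2) = Some (Posz (a %/ b)).
Proof.
move=> h1 h2 b0 aW; apply: ev_bin h1 h2 _ _ => /=; last exact: leq_trans (leq_div _ _) aW.
by rewrite divz_nat; case: b b0.
Qed.

Lemma ev_le e1 e2 (a b : nat) : eval W s e1 = Some (Posz a) ->
  eval W s e2 = Some (Posz b) -> eval_test W s (Test Le e1 e2) = Some (a <= b).
Proof. by rewrite /= => -> ->. Qed.

Lemma ev_lt e1 e2 (a b : nat) : eval W s e1 = Some (Posz a) ->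
  eval W s e2 = Some (Posz b) -> eval_test W s (Test Lt e1 e2) = Some (a < b).
Proof. by rewrite /= => -> ->. Qed.

Lemma ev_eq e1 e2 v1 v2 : eval W s e1 = Some v1 ->
  eval W s e2 = Some v2 -> eval_test W s (Test Eq e1 e2) = Some (v1 == v2).
Proof. by rewrite /= => -> ->. Qed.

End Eval.

(** Total correctness with a time bound.  The numerals in the bounds below are
    costs of concrete expressions, added up; the rules are stated so that these
    costs are found by conversion. *)
Definition wp (W : nat) (c : cmd) (t : nat) (Q : store -> Prop) (s : store) : Prop :=
  exists t' s', [/\ exec W c s t' s', t' <= t & Q s'].

Section Rules.
Context (W : nat).
Implicit Types (c : cmd) (Q : store -> Prop) (s : store).

Lemma wp_time c t1 t2 Q s : t1 <= t2 -> wp W c t1 Q s -> wp W c t2 Q s.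
Proof. by move=> t12 [t [s' [ex tt q]]]; exists t, s'; split=> //; apply: leq_trans t12. Qed.

Lemma wp_conseq c t (Q1 Q2 : store -> Prop) s :
  (forall s', frame c s s' -> Q1 s' -> Q2 s') -> wp W c t Q1 s -> wp W c t Q2 s.
Proof.
move=> Q12 [t' [s' [ex tt q]]]; exists t', s'; split=> //.
exact: Q12 (exec_frame ex) q.
Qed.

Lemma wp_skip t Q s : Q s -> wp W Skip t Q s.
Proof. by move=> q; exists 0, s; split=> //; constructor. Qed.

Lemma wp_assign x e v Q s :
  eval W s e = Some v -> Q (set_reg s x v) -> wp W (Assign x e) (cost_expr e).+1 Q s.
Proof. by move=> ev q; exists (cost_expr e).+1, (set_reg s x v); split=> //; constructor. Qed.

Lemma wp_put a e1 e2 j v Q s :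
  eval W s e1 = Some (Posz j) -> eval W s e2 = Some v -> Q (set_mem s a j v) ->
  wp W (Put a e1 e2) (cost_expr e1 + cost_expr e2).+1 Q s.
Proof.
move=> ev1 ev2 q; exists (cost_expr e1 + cost_expr e2).+1, (set_mem s a j v).
by split=> //; constructor.
Qed.

Lemma wp_seq c1 c2 t1 t2 Q s :
  wp W c1 t1 (wp W c2 t2 Q) s -> wp W (Seq c1 c2) (t1 + t2) Q s.
Proof.
move=> [t1' [s1 [ex1 le1 [t2' [s2 [ex2 le2 q]]]]]].
by exists (t1' + t2'), s2; split; [apply: ExecSeq ex1 ex2 | apply: leq_add | ].
Qed.

Lemma wp_call c1 c2 t1 t2 Q1 Q s :
  wp W c1 t1 Q1 s -> (forall s', frame c1 s s' -> Q1 s' -> wp W c2 t2 Q s') ->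
  wp W (Seq c1 c2) (t1 + t2) Q s.
Proof. by move=> w1 w2; apply: wp_seq; apply: wp_conseq w1. Qed.

Lemma wp_if b (r : bool) c1 c2 t1 t2 Q s :
  eval_test W s b = Some r ->
  (r -> wp W c1 t1 Q s) -> (~~ r -> wp W c2 t2 Q s) ->
  wp W (If b c1 c2) (cost_test b + maxn t1 t2) Q s.
Proof.
case: r => ev w1 w2.
  have [t [s' [ex le q]]] := w1 isT; exists (cost_test b + t), s'; split=> //.
    exact: ExecIfTrue.
  by rewrite leq_add2l leq_max le.
have [t [s' [ex le q]]] := w2 isT; exists (cost_test b + t), s'; split=> //.
  exact: ExecIfFalse.
by rewrite leq_add2l leq_max le orbT.
Qed.

(** The index of the invariant is a time credit: every turn is paid out of it,
    so the loop terminates because its test alone costs something. *)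
Lemma wp_while b c (Inv : nat -> store -> Prop) Q n s :
  Inv n s ->
  (forall k s', frame c s s' -> Inv k s' ->
     [/\ eval_test W s' b = Some false, Q s' & cost_test b <= k] \/
     eval_test W s' b = Some true /\
     exists t, wp W c t (fun s'' =>
       exists2 k', cost_test b + t + k' <= k & Inv k' s'') s') ->
  wp W (While b c) n Q s.
Proof.
move=> inv step; move: (frame_refl c s) inv; move: {2 3 4}s => s'.
(* The credit decreases strictly, as [cost_test b] is positive. *)
elim/ltn_ind: n s' => n IH s1 f1 inv.
have [[ev q nt]|[ev [t [t1 [s2 [ex1 le1 [k kn inv']]]]]]] := step _ _ f1 inv.
  by exists (cost_test b), s1; split=> //; apply: ExecWhileFalse.
have ct : 0 < cost_test b by case: (b).
have [|t2 [s3 [ex2 le2 q]]] := IH k _ _ (frame_trans f1 (exec_frame ex1)) inv'.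
  lia.
exists (cost_test b + t1 + t2), s3; split=> //; first exact: ExecWhileTrue ex1 ex2.
lia.
Qed.

(** The usual case of [wp_while]: turns of bounded cost and a counter that
    decreases, possibly by more than one, at each turn. *)
Lemma wp_while_count b c tc (Inv : nat -> store -> Prop) Q m s :
  Inv m s ->
  (forall k s', frame c s s' -> Inv k s' ->
     (eval_test W s' b = Some false /\ Q s') \/
     (eval_test W s' b = Some true /\
      wp W c tc (fun s'' => exists2 k', k' < k & Inv k' s'') s')) ->
  wp W (While b c) (cost_test b + m * (cost_test b + tc)) Q s.
Proof.
move=> inv step.
pose credit k := cost_test b + k * (cost_test b + tc).
apply: (@wp_while _ _ (fun n s' => exists2 k, n = credit k & Inv k s')).
  by exists m.
move=> _ s' fr [k -> inv']; case: (step k s' fr inv') => [[ev q]|[ev w]].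
  by left; split=> //; rewrite leq_addr.
right; split=> //; exists tc; apply: wp_conseq w => s'' _ [k' kk inv''].
exists (credit k'); last by exists k'.
by case: k kk {inv'} => // k; rewrite ltnS /credit => kk; nia.
Qed.

(** The body of a counting loop; [frame_bump] holds because the loop writes its
    own counter. *)
Let bump (op : binop) (x : reg) c := Seq c (Assign x (Bin op x 1%expr)).

Lemma frame_bump op x c s s' v :
  frame (bump op x c) s s' -> frame (bump op x c) s (set_reg s' x v).
Proof.
move=> [r m]; split=> y /= wy; last by rewrite m.
by move: (wy); rewrite negb_or => /andP[_ /negPf ->]; apply: r.
Qed.

(** [J i] describes the store before turn [i].  It may not depend on the counter
    itself, so that it survives the update of the counter, which costs 4. *)
Lemma wp_for_up (x : reg) (e1 e2 : expr) c (a b : nat) (tc : nat -> nat)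
    (J : nat -> store -> Prop) s :
  let ct := cost_test (Test Le x e2) in
  a <= b.+1 -> b.+1 <= W -> ~~ writes_reg c x ->
  eval W s e1 = Some (Posz a) ->
  (forall i s' v, J i s' -> J i (set_reg s' x v)) ->
  J a s ->
  (forall i s', i <= b.+1 -> frame (bump Add x c) s s' -> J i s' ->
     eval W s' e2 = Some (Posz b)) ->
  (forall i s', a <= i <= b -> frame (bump Add x c) s s' ->
     regs s' x = Posz i -> J i s' -> wp W c (tc i) (J i.+1) s') ->
  wp W (for_up x e1 e2 c)
    ((cost_expr e1).+1 + (ct + \sum_(a <= i < b.+1) (ct + tc i + 4))) (J b.+1) s.
Proof.
move=> ct ab bW wx ev1 Jx Ja ev2 body.
have evx s' i : regs s' x = Posz i -> i <= b.+1 -> eval W s' x = Some (Posz i).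
  by move=> xi ib; apply: ev_var xi _; apply: leq_trans bW.
apply: wp_seq; apply: wp_assign ev1 _.
apply: (@wp_while _ _ (fun k s' => exists i, [/\ a <= i <= b.+1,
  k = ct + \sum_(i <= j < b.+1) (ct + tc j + 4), regs s' x = Posz i & J i s'])).
  by exists a; split=> //=; [rewrite leqnn | rewrite eqxx | apply: Jx].
move=> _ s' fr0 [i [/andP[ai ib] -> xi Ji]].
have fr : frame (bump Add x c) s s' by apply: frame_trans fr0; apply: frame_bump.
have -> := ev_le (evx _ _ xi ib) (ev2 _ _ ib fr Ji).
have [ib'|bi] := leqP i b; last first.
  have ei : i = b.+1 by lia.
  by left; split=> //; [rewrite -ei | rewrite leq_addr].
right; split=> //; exists (tc i + 4); apply: wp_seq.
apply: wp_conseq (body i s' _ fr xi Ji); last by rewrite ai.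
move=> s1 [fr1 _] Ji1; have x1 : regs s1 x = Posz i by rewrite fr1.
apply: (@wp_assign x (x + 1)%expr (Posz (i + 1))).
  apply: ev_add; first by apply: evx x1 _; lia.
    by apply: ev_cst => /=; lia.
  lia.
rewrite addn1; exists (ct + \sum_(i.+1 <= j < b.+1) (ct + tc j + 4)).
  by rewrite (@big_ltn _ _ _ i b.+1) // -/ct; lia.
by exists i.+1; split=> //=; [lia | rewrite eqxx | apply: Jx].
Qed.

Lemma wp_for_down (x : reg) (e1 : expr) c (b : nat) (tc : nat -> nat)
    (J : nat -> store -> Prop) s :
  b < W -> ~~ writes_reg c x ->
  eval W s e1 = Some (Posz b) ->
  (forall i s' v, J i s' -> J i (set_reg s' x v)) ->
  J b s ->
  (forall i s', 0 < i <= b -> frame (bump Sub x c) s s' ->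
     regs s' x = Posz i -> J i s' -> wp W c (tc i) (J i.-1) s') ->
  wp W (for_down x e1 1 c)
    ((cost_expr e1).+1 + (3 + \sum_(1 <= i < b.+1) (3 + tc i + 4))) (J 0) s.
Proof.
move=> bW wx ev1 Jx Ja body.
have evx s' i : regs s' x = Posz i -> i <= b -> eval W s' x = Some (Posz i).
  by move=> xi ib; apply: ev_var xi _; rewrite (leq_trans ib) // ltnW.
have ev1W s' : eval W s' 1%expr = Some (Posz 1) by apply: ev_cst => /=; lia.
apply: wp_seq; apply: wp_assign ev1 _.
apply: (@wp_while _ _ (fun k s' => exists i, [/\ i <= b,
  k = 3 + \sum_(1 <= j < i.+1) (3 + tc j + 4), regs s' x = Posz i & J i s'])).
  by exists b; split=> //=; [rewrite eqxx | apply: Jx].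
move=> _ s' fr0 [i [ib -> xi Ji]].
have fr : frame (bump Sub x c) s s' by apply: frame_trans fr0; apply: frame_bump.
have -> := ev_le (ev1W s') (evx _ _ xi ib).
case: i ib xi Ji => [|i] ib xi Ji; first by left; split=> //; rewrite leq_addr.
right; split=> //; exists (tc i.+1 + 4); apply: wp_seq.
apply: wp_conseq (body i.+1 s' _ fr xi Ji) => //.
move=> s1 [fr1 _] Ji1; have x1 : regs s1 x = Posz i.+1 by rewrite fr1.
apply: (@wp_assign x (x - 1)%expr (Posz (i.+1 - 1))).
  by apply: ev_sub (evx _ _ x1 ib) (ev1W s1) _ _ => //; lia.
rewrite subn1; exists (3 + \sum_(1 <= j < i.+1) (3 + tc j + 4)).
  by rewrite (@big_nat_recr _ _ _ i.+1) //=; lia.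
by exists i; split=> //=; [lia | rewrite eqxx | apply: Jx].
Qed.

End Rules.

(** * Correctness and cost of the algorithm *)

Lemma sqrt_unique q r : r * r <= q -> q < r.+1 * r.+1 -> Nat.sqrt q = r.
Proof.
move=> rq qr; apply/eqP; rewrite eqn_leq -ltnS ltnNge !leq_sqrt rq.
by rewrite -ltnNge qr.
Qed.

(** Each turn of the bisection halves [hi - lo], rounding up, so that [k] turns
    suffice when [q < 2 ^ k]. *)
Lemma wp_isqrt W x e q k s : eval W s e = Some (Posz q) ->
  4 * q.+1 ^ 2 <= W -> q < 2 ^ k ->
  wp W (isqrt x e) (cost_expr e + 14 + 18 * k)
    (fun s' => regs s' x = Posz (Nat.sqrt q)) s.
Proof.
move=> ev qW qk; have qW2 : 4 * q.+1 <= W by apply: leq_trans qW; rewrite -mulnn; nia.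
have W2 : 4 <= W by lia.
apply: (@wp_time _ _ ((cost_expr e).+1 + (2 + (4 + ((5 + k * (5 + 13)) + 2)))) ); first lia.
apply: wp_seq; apply: wp_assign ev _.
apply: wp_seq; apply: (@wp_assign _ _ _ (Posz 0)); first exact: ev_cst.
apply: wp_seq; apply: (@wp_assign _ _ _ (Posz (q + 1))).
  by apply: ev_add; [apply: ev_var => /=; last lia | apply: ev_cst => /=; lia | lia].
apply: wp_seq; set s1 := set_reg _ hi_ _.
apply: (@wp_while_count _ _ _ 13 (fun k s' => exists lo hi,
  [/\ regs s' lo_ = Posz lo, regs s' hi_ = Posz hi, lo < hi <= q.+1,
      lo * lo <= q < hi * hi & hi <= lo + 2 ^ k])).
  exists 0, q.+1; split=> //; first by congr Posz; rewrite addn1.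
  - by lia.
  - by rewrite mul0n leq_pmulr.
move=> m s' [fr _] [lo [hi [lo_E hi_E /andP[lohi hiq] /andP[loq qhi] him]]].
have q_E : regs s' q_ = Posz q by rewrite fr.
have ev_lo : eval W s' lo_ = Some (Posz lo) by apply: ev_var lo_E _ => /=; lia.
have ev_hi : eval W s' hi_ = Some (Posz hi) by apply: ev_var hi_E _ => /=; lia.
have ev_lo1 : eval W s' (lo_ + 1)%expr = Some (Posz (lo + 1)).
  by apply: ev_add ev_lo _ _; [apply: ev_cst => /=; lia | lia].
have -> := ev_lt ev_lo1 ev_hi.
have [lt1|le1] := ltnP (lo + 1) hi; [right|left]; split=> //; last first.
  apply: (@wp_assign _ _ _ (Posz lo) _ _ ev_lo) => /=.
  rewrite eqxx (@sqrt_unique q lo) //.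
  by have <- : hi = lo.+1 by lia.
case: m him => [|m] him; first by rewrite expn0 in him; lia.
rewrite expnS in him; set mid := (lo + hi) %/ 2.
have [midlo midhi] : lo < mid /\ mid < hi by rewrite /mid; lia.
have midq : mid * mid <= W by rewrite -mulnn in qW; nia.
apply: (@wp_time _ _ (6 + (5 + maxn 2 2))) => //.
apply: wp_seq; apply: (@wp_assign _ _ _ (Posz mid)).
  apply: ev_div; [|by apply: ev_cst => /=; lia|by []|].
    by apply: ev_add ev_lo ev_hi _; lia.
  lia.
set s2 := set_reg _ _ _.
have ev_mid : eval W s2 mid_ = Some (Posz mid) by apply: ev_var => //=; lia.
have ev_q : eval W s2 q_ = Some (Posz q) by apply: ev_var => //=; lia.
apply: (@wp_if _ _ _ _ _ 2 2).
- by apply: ev_le ev_q; apply: (ev_mul ev_mid ev_mid).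
- move=> mq; apply: (wp_assign ev_mid); exists m => //; exists mid, hi.
  by split=> //; rewrite ?mq ?midhi ?hiq //; rewrite /mid; lia.
- rewrite -ltnNge => mq; apply: (wp_assign ev_mid); exists m => //; exists lo, mid.
  by split=> //; rewrite ?mq ?midlo ?loq //; rewrite /mid; lia.
Qed.

(** The loop shared by the three crossing-out passes: it visits the multiples
    [p * c] with [c0 <= c <= D %/ p] and applies [g] to their entries in the
    array [a].  Each visit reads an entry that no earlier visit has touched,
    whence the hypothesis on [e]. *)
Lemma wp_stride W D a e st (g : int -> int) p c0 s :
  let body := (Put a k_ e ;; k_ ::= k_ + st)%cmd in
  0 < p -> 0 < c0 -> D + p <= W -> p * c0 <= W ->
  regs s D_ = Posz D -> regs s k_ = Posz (p * c0) ->
  (forall s', frame body s s' -> eval W s' st = Some (Posz p)) ->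
  (forall j s', p * c0 <= j <= D -> frame body s s' -> regs s' k_ = Posz j ->
     mem s' a j = mem s a j -> eval W s' e = Some (g (mem s a j))) ->
  wp W (While (k_ <= D_) body)
    (3 + (D %/ p) * (3 + (cost_expr e + cost_expr st + 5)))
    (fun s' => forall j, mem s' a j =
       if [&& p * c0 <= j <= D & p %| j] then g (mem s a j) else mem s a j) s.
Proof.
move=> body p0 c00 DpW pcW D_E k_E ev_st ev_e.
apply: (@wp_time _ _ (3 + ((D %/ p).+1 - c0) * (3 + (cost_expr e + cost_expr st + 5)))).
  by case: (c0) c00 => // c1 _; rewrite subSS leq_add2l leq_mul2r leq_subr orbT.
apply: (@wp_while_count _ _ _ _ (fun m s' => exists c,
  [/\ c0 <= c, m = (D %/ p).+1 - c, p * c <= W, regs s' k_ = Posz (p * c) &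
   forall j, mem s' a j = if [&& p * c0 <= j < p * c, j <= D & p %| j]
                          then g (mem s a j) else mem s a j])).
  exists c0; split=> // j; case: ifP => // /andP[/andP[h1 h2] _].
  by rewrite ltnNge h1 in h2.
move=> m s' fr [c [c0c -> pcW' k'_E mem_E]].
have D'_E : regs s' D_ = Posz D by rewrite (proj1 fr).
have ev_k : eval W s' k_ = Some (Posz (p * c)) by apply: ev_var k'_E _.
have ev_D : eval W s' D_ = Some (Posz D) by apply: ev_var D'_E _ => /=; lia.
have -> := ev_le ev_k ev_D.
have [pcD|Dpc] := leqP (p * c) D; [right|left]; split=> //; last first.
  move=> j; rewrite mem_E; congr (if _ then _ else _).
  have [jD|] := leqP j D; last by rewrite !andbF.
  by rewrite (leq_ltn_trans jD Dpc) !andbT.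
have cDp : c <= D %/ p by rewrite leq_divRL // mulnC.
apply: (@wp_time _ _ ((1 + cost_expr e).+1 + (cost_expr (k_ + st)%expr).+1)).
  by rewrite /=; lia.
have mem_c : mem s' a (p * c) = mem s a (p * c) by rewrite mem_E ltnn andbF.
have pc_range : p * c0 <= p * c <= D by rewrite leq_pmul2l // c0c.
apply: wp_seq; apply: (wp_put ev_k (ev_e _ _ pc_range fr k'_E mem_c)).
set s2 := set_mem _ _ _ _.
have fr2 : frame body s s2.
  case: fr => r m'; split=> y wy; first by rewrite -r.
  rewrite -m' //=; apply/boolp.funext => l; case: eqP => //= ya.
  by move: wy; rewrite /= ya eqxx.
apply: (@wp_assign _ _ _ (Posz (p * c + p))).
  by apply: ev_add (ev_st _ fr2) _; [apply: ev_var | lia].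
exists ((D %/ p).+1 - c.+1); first lia.
exists c.+1; split=> //; first lia.
- by rewrite mulnS; lia.
- by rewrite /= mulnS addnC.
move=> j /=; rewrite eqxx /= mem_E.
have [-> /=|jpc] := eqVneq j (p * c).
  by rewrite pcD dvdn_mulr // ltn_pmul2l // ltnSn leq_pmul2l // c0c.
congr (if _ then _ else _).
have [/dvdnP[q jq]|] := boolP (p %| j); last by rewrite !andbF.
rewrite jq mulnC in jpc *; rewrite !ltn_pmul2l // ltnS (leq_eqVlt q c).
rewrite eqn_pmul2l // in jpc; by rewrite (negPf jpc).
Qed.

Lemma wp_fill W D a v s : D.+1 <= W -> absz v <= W -> regs s D_ = Posz D ->
  wp W (for_up d_ 1 D_ (Put a d_ (Cst v))) (5 + 10 * D)
    (fun s' => forall j, 0 < j <= D -> mem s' a j = v) s.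
Proof.
move=> DW vW D_E.
have DE s' : regs s' D_ = Posz D -> eval W s' D_ = Some (Posz D).
  by move=> E; apply: ev_var E _ => /=; lia.
apply: (@wp_time _ _ (2 + (3 + \sum_(1 <= i < D.+1) (3 + 3 + 4)))).
  by rewrite sum_nat_const_nat; lia.
apply: (@wp_for_up _ d_ _ _ _ 1 D (fun=> 3)
  (fun i s' => forall j, 0 < j < i -> mem s' a j = v)) => //.
- by apply: ev_cst => /=; lia.
- by move=> j; case: j => [|[]].
- by move=> i s' _ [fr _] _; apply: DE; rewrite fr.
move=> i s' /andP[i1 iD] fr iE IH; apply: (@wp_put _ _ _ _ i v).
- by apply: ev_var iE _ => /=; lia.
- exact: ev_cst.
by move=> j ji /=; rewrite eqxx /=; case: eqP => // /eqP nji; apply: IH; lia.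
Qed.

(** The state of the entry [j] of the sieve of Eratosthenes when the loop over
    primes reaches [p]. *)
Definition composite_upto p j :=
  has (fun q => [&& prime q, q %| j & q < j]) (index_iota 2 p).

Lemma composite_uptoS p j : 1 < p ->
  composite_upto p.+1 j = composite_upto p j || [&& prime p, p %| j & p < j].
Proof.
move=> p2; rewrite /composite_upto /index_iota subSn // -[(p - 2).+1]addn1 iotaD has_cat /=.
by rewrite subnKC // orbF.
Qed.

(** The entry of [j] is final when the loop reaches [j], because the least prime
    factor of a composite [j] is smaller than [j]: the loop tests its index
    against the right value. *)
Lemma composite_uptoE p j : 1 < j -> j <= p -> composite_upto p j = ~~ prime j.
Proof.
move=> j1 jp; apply/hasP/idP => [[q _ /and3P[pq qj ltqj]]|npj].
  by apply/negP => pj; move: qj ltqj; rewrite dvdn_prime2 // => /eqP ->; rewrite ltnn.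
have lt_pdiv : pdiv j < j.
  rewrite ltn_neqAle pdiv_leq ?andbT; last lia.
  by apply: contra npj => /eqP <-; rewrite pdiv_prime.
exists (pdiv j); last by rewrite pdiv_prime // pdiv_dvd lt_pdiv.
by rewrite mem_index_iota prime_gt1 ?pdiv_prime // (leq_trans lt_pdiv).
Qed.

Lemma sum_prime_cost A B D F :
  (forall p, F p <= A + B * (if prime p then D %/ p else 0)) ->
  \sum_(2 <= p < D.+1) F p <= A * D + B * prime_quotients D.
Proof.
move=> FAB; apply: (@leq_trans (\sum_(2 <= p < D.+1) (A + B * (if prime p then D %/ p else 0)))).
  exact: leq_sum.
rewrite big_split /= sum_nat_const_nat -big_distrr /= /prime_quotients -big_mkcond /=.
by rewrite leq_add2r mulnC leq_mul2l; apply/orP; right; lia.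
Qed.

Lemma wp_when_prime W p c t Q s :
  eval W s (COMP.[p_])%expr = Some (Posz (~~ prime p)) ->
  (prime p -> wp W c t Q s) -> (~~ prime p -> Q s) ->
  wp W (when (COMP.[p_] == 0)%test c) (4 + (if prime p then t else 0)) Q s.
Proof.
move=> ev w q.
have W0 : eval W s 0%expr = Some (Posz 0) by exact: ev_cst.
have ev_b : eval_test W s (COMP.[p_] == 0)%test = Some (prime p).
  by rewrite (ev_eq ev W0); case: (prime p).
case pp : (prime p) in ev_b w q *.
  by rewrite -[X in 4 + X]maxn0; apply: (wp_if ev_b) => // _; apply: w.
rewrite -[X in 4 + X](maxn0 0); apply: (wp_if ev_b) => // _.
by apply: wp_skip; apply: q.
Qed.

Section Sieve.
Context (W D : nat).
Hypotheses (D0 : 0 < D) (DW : 4 * D.+1 ^ 2 <= W).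

Let DW1 : 4 * D.+1 <= W.
Proof. by apply: leq_trans DW; rewrite -mulnn; nia. Qed.

Lemma wp_eratosthenes s : regs s D_ = Posz D ->
  wp W eratosthenes (12 + 36 * D + 10 * prime_quotients D)
    (fun s' => forall p, 1 < p <= D -> mem s' COMP p = Posz (~~ prime p)) s.
Proof.
move=> D_E.
have W2 : 2 < W by lia.
pose tc p := 4 + (if prime p then 4 + (3 + (D %/ p) * 10) else 0).
apply: (@wp_time _ _ ((5 + 10 * D) + (2 + (3 + \sum_(2 <= i < D.+1) (3 + tc i + 4))))).
  rewrite -/(10 * D).
  suff : \sum_(2 <= i < D.+1) (3 + tc i + 4) <= 18 * D + 10 * prime_quotients D by lia.
  by apply: sum_prime_cost => p; rewrite /tc; case: prime; lia.
apply: wp_call; first by apply: (wp_fill COMP _ _ D_E) => //; lia.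
move=> s1 [fr1 _] COMP1; have {}D_E : regs s1 D_ = Posz D by rewrite fr1.
apply: (@wp_conseq _ _ _ (fun s' => forall j, 0 < j <= D ->
    mem s' COMP j = Posz (composite_upto D.+1 j))).
  move=> s' _ COMP' p /andP[p1 pD]; rewrite COMP' ?composite_uptoE //; lia.
apply: (@wp_for_up _ p_ _ _ _ 2 D tc (fun p s' => forall j, 0 < j <= D ->
    mem s' COMP j = Posz (composite_upto p j))) => //; first lia.
- by apply: ev_cst; lia.
- by move=> i s' _ [fr _] _; apply: ev_var; [rewrite fr | move=> /=; lia].
move=> p s' /andP[p1 pD] [fr _] p_E IH.
have ev_p s2 : regs s2 p_ = Posz p -> eval W s2 p_ = Some (Posz p).
  by move=> E; apply: ev_var E _ => /=; lia.
apply: wp_when_prime.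
- by apply: (ev_get (ev_p _ p_E)); [rewrite IH ?composite_uptoE //; lia | case: prime => //=; lia].
- move=> pp; apply: wp_seq.
  apply: (@wp_assign _ _ _ (Posz (p + p))).
    by apply: ev_add (ev_p _ p_E) (ev_p _ p_E) _; lia.
  set s2 := set_reg _ _ _; pose g (_ : int) := 1%R : int.
  apply: (@wp_conseq _ _ _ (fun s3 => forall j, mem s3 COMP j =
       if [&& p * 2 <= j <= D & p %| j] then g (mem s2 COMP j) else mem s2 COMP j)).
    move=> s3 _ E j jD; rewrite E composite_uptoS // IH // pp /=.
    case: (boolP (p %| j)) => [/dvdnP[q jq]|]; last by rewrite andbF orbF.
    have -> : (p < j) = (p * 2 <= j).
      by rewrite jq mulnC -{1}(muln1 p) ltn_pmul2l ?leq_pmul2l //; lia.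
    rewrite andbT; case: leqP; last by rewrite orbF.
    by rewrite orbT (proj2 (andP jD)).
  apply: (@wp_stride _ D COMP 1%expr p_ g p 2) => //; try lia.
  + by rewrite /s2 /= fr.
  + by rewrite /s2 /= muln2 addnn.
  + by move=> s3 [fr3 _]; apply: ev_p; rewrite fr3.
  + by move=> j s3 _ _ _ _; apply: ev_cst; lia.
- move=> npp j jD; rewrite composite_uptoS // IH //.
  by rewrite (negPf npp) orbF.
Qed.

(** The part of the first step that fills the array [MU]. *)
Definition mobius_sieve : cmd :=
  (for_up d_ 1 D_ (Put MU d_ 1) ;;
   for_up p_ 2 D_
     (when (COMP.[p_] == 0)
        (for_multiples (p_ * p_) (Put MU k_ 0) ;;
         for_multiples p_ (Put MU k_ (0 - MU.[k_])))))%cmd.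

Lemma mu_upto2 j : mu_upto 2 j = 1%R.
Proof. by rewrite !mu_uptoS /= !mulr1 /mu_upto big_geq. Qed.

Lemma wp_mobius_sieve s : regs s D_ = Posz D ->
  (forall p, 1 < p <= D -> mem s COMP p = Posz (~~ prime p)) ->
  wp W mobius_sieve (10 + 33 * D + 25 * prime_quotients D)
    (fun s' => forall j, 0 < j <= D -> mem s' MU j = mu j) s.
Proof.
move=> D_E COMP_E.
have W2 : 2 < W by lia.
pose tc p := 4 + (if prime p then (4 + (3 + D %/ (p * p) * 12)) + (2 + (3 + (D %/ p) * 13))
                  else 0).
apply: (@wp_time _ _ ((5 + 10 * D) + (2 + (3 + \sum_(2 <= i < D.+1) (3 + tc i + 4))))).
  suff : \sum_(2 <= i < D.+1) (3 + tc i + 4) <= 23 * D + 25 * prime_quotients D by lia.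
  apply: sum_prime_cost => p; rewrite /tc; case pp: (prime p); last lia.
  have : D %/ (p * p) <= D %/ p by rewrite divnMA leq_div.
  by lia.
apply: wp_call; first by apply: (wp_fill MU _ _ D_E) => //; lia.
move=> s1 [fr1 mfr1] MU1; have {}D_E : regs s1 D_ = Posz D by rewrite fr1.
have {}COMP_E p : 1 < p <= D -> mem s1 COMP p = Posz (~~ prime p).
  by rewrite mfr1 //; apply: COMP_E.
apply: (@wp_conseq _ _ _ (fun s' => forall j, 0 < j <= D ->
    mem s' MU j = mu_upto D.+1 j)).
  move=> s' _ MU' j /andP[j0 jD]; rewrite MU' ?mu_uptoE //; lia.
apply: (@wp_for_up _ p_ _ _ _ 2 D tc (fun p s' => forall j, 0 < j <= D ->
    mem s' MU j = mu_upto p j)) => //; first lia.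
- by apply: ev_cst; lia.
- by move=> j jD; rewrite MU1 // mu_upto2.
- by move=> i s' _ [fr _] _; apply: ev_var; [rewrite fr | move=> /=; lia].
move=> p s' /andP[p1 pD] [fr mfr] p_E IH.
have ppD : p * p <= D * D by rewrite leq_mul.
have ppW : D + p * p + 1 <= W by apply: leq_trans DW; rewrite -mulnn; nia.
have ev_p s2 : regs s2 p_ = Posz p -> eval W s2 p_ = Some (Posz p).
  by move=> E; apply: ev_var E _ => /=; lia.
have ev_pp s2 : regs s2 p_ = Posz p -> eval W s2 (p_ * p_)%expr = Some (Posz (p * p)).
  by move=> E; apply: (ev_mul (ev_p _ E) (ev_p _ E)); lia.
apply: wp_when_prime.
- apply: (ev_get (ev_p _ p_E)); last by case: prime => //=; lia.
  by rewrite mfr // COMP_E //; lia.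
- move=> pp; apply: wp_seq.
  apply: wp_seq; apply: (@wp_assign _ _ _ (Posz (p * p))); first exact: ev_pp.
  set s2 := set_reg _ _ _.
  apply: wp_conseq; last first.
    apply: (@wp_stride _ D MU 0%expr (p_ * p_)%expr (fun=> 0%R) (p * p) 1) => //; try nia.
    + by rewrite /s2 /= fr.
    + by rewrite /s2 /= muln1.
    + by move=> s3 [fr3 _]; apply: ev_pp; rewrite fr3.
  move=> s3 [fr3 mfr3] MU3.
  have p3_E : regs s3 p_ = Posz p by rewrite fr3.
  apply: wp_seq; apply: (@wp_assign _ _ _ (Posz p)); first exact: ev_p.
  set s4 := set_reg _ _ _.
  apply: wp_conseq; last first.
    apply: (@wp_stride _ D MU (0 - MU.[k_])%expr p_ (fun v => - v)%R p 1) => //; try lia.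
    + by rewrite /s4 /= fr3 // /s2 /= fr.
    + by rewrite /s4 /= muln1.
    + by move=> s5 [fr5 _]; apply: ev_p; rewrite fr5.
    + move=> j s5 /andP[]; rewrite muln1 => pj jD _ k_E5 MU5.
      have ev0 : eval W s5 0%expr = Some 0%R by exact: ev_cst.
      have small : absz (mem s4 MU j) <= 1.
        rewrite /s4 /= MU3; case: ifP => // _; rewrite /s2 /= IH; last lia.
        by have := normr_mu_upto p j; lia.
      apply: (@ev_bin _ _ Sub _ _ 0%R (mem s4 MU j)) => //; last lia.
        by apply: ev_get MU5 _; [apply: ev_var k_E5 _ => /=; lia | lia].
      by rewrite /= add0r.
  move=> s5 _ MU5 j /andP[j0 jD]; rewrite MU5 /s4 /= MU3 /s2 /= IH ?j0 //.
  rewrite mu_uptoS pp /mu_factor !muln1 jD !andbT mulnn.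
  (* The stride starts at [q], which excludes no positive multiple of [q]. *)
  have le_dvd q : (q <= j) && (q %| j) = (q %| j).
    by case: (boolP (q %| j)) => [/(dvdn_leq j0) ->|]; rewrite ?andbF.
  rewrite !le_dvd; have [p2j|_] := boolP (p ^ 2 %| j).
    by rewrite mulr0 oppr0 if_same.
  by case: ifP; rewrite ?mulr1 ?mulrN1.
- move=> npp j jD; rewrite mu_uptoS (negPf npp) mulr1; exact: IH.
Qed.

End Sieve.

(** Sequences associate to the right; this allows to treat the first two
    commands of a sequence as one block. *)
Lemma wp_seqA W c1 c2 c3 t Q s :
  wp W (Seq (Seq c1 c2) c3) t Q s -> wp W (Seq c1 (Seq c2 c3)) t Q s.
Proof.
move=> [t' [s' [ex le q]]]; exists t', s'; split=> //.
inversion ex as [| | |? ? ? ? ? ? ? ex12 ex3| | | |]; subst.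
inversion ex12; subst.
by rewrite -addnA; econstructor; [eassumption | econstructor; eassumption].
Qed.

(** Used to check that no partial sum leaves the range of the machine words. *)
Lemma absz_sum_nat (F : nat -> int) B a b :
  (forall i, a <= i < b -> absz (F i) <= B) ->
  absz (\sum_(a <= i < b) F i)%R <= (b - a) * B.
Proof.
elim: b => [|b IH] FB; first by rewrite big_geq.
have [ab|ba] := leqP a b; last by rewrite big_geq.
rewrite big_nat_recr //= subSn // mulSn.
have IHb : absz (\sum_(a <= i < b) F i)%R <= (b - a) * B.
  by apply: IH => // i /andP[ai ib]; apply: FB; rewrite ai ltnW.
have Fb : absz (F b) <= B by apply: FB; rewrite ab ltnSn.
have absD (u v : int) : absz (u + v)%R <= absz v + absz u by lia.
by apply: leq_trans (absD _ _) (leq_add Fb IHb).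
Qed.

(** The indices [j] from [d] up to [x %/ (x %/ d)] share the quotient of [d]. *)
Lemma divn_group x d j : 0 < d -> d <= j <= x %/ (x %/ d) -> d <= x -> x %/ j = x %/ d.
Proof.
move=> d0 /andP[dj jx] dx; have v0 : 0 < x %/ d by rewrite divn_gt0.
have j0 : 0 < j by apply: leq_trans dj.
apply/eqP; rewrite eqn_leq leq_div2l //= leq_divRL //.
by rewrite mulnC -leq_divRL.
Qed.

Section Algorithm.
Context (W n I k : nat).
Hypotheses (I0 : 0 < I) (In : I <= n) (nW : 4 * n.+1 ^ 2 <= W) (nk : n < 2 ^ k).

Let D := sqrt_quot n I.

Let nW1 : 4 * n.+1 <= W.
Proof. by apply: leq_trans nW; rewrite -mulnn; nia. Qed.

Let nnW : n * n + 2 * n + 1 <= W.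
Proof. by apply: leq_trans nW; rewrite -mulnn; nia. Qed.

Lemma sqrt_quot_gt0 i : i <= n -> 0 < i -> 0 < sqrt_quot n i.
Proof. by move=> i_n i0; rewrite /sqrt_quot leq_sqrt divn_gt0. Qed.

Lemma sqrt_quot_sqr i : sqrt_quot n i * sqrt_quot n i <= n.
Proof. by rewrite (leq_trans _ (leq_div n i)) // -leq_sqrt. Qed.

Lemma sqrt_quot_leq i : sqrt_quot n i <= n.
Proof. by apply: leq_trans (sqrt_quot_sqr i); case: (sqrt_quot n i) => // m; rewrite leq_pmulr. Qed.

Let D0 : 0 < D. Proof. exact: sqrt_quot_gt0. Qed.
Let Dn : D <= n. Proof. exact: sqrt_quot_leq. Qed.
Let DDn : D * D <= n. Proof. exact: sqrt_quot_sqr. Qed.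
Let DW : 4 * D.+1 ^ 2 <= W.
Proof. by apply: leq_trans nW; rewrite leq_mul2l leq_exp2r //= ltnS. Qed.

(** The value of the register [S1_] when the register [d_] contains [i]. *)
Definition head_sum i : int := (\sum_(1 <= d < i) mu d *+ (n %/ (d * d))%N)%R.

Lemma absz_head_sum i : absz (head_sum i) <= i * n.
Proof.
apply: (@leq_trans ((i - 1) * n)); last by rewrite leq_mul2r leq_subr orbT.
apply: absz_sum_nat => d _; rewrite -mulr_natr abszM.
have mu1 : absz (mu d) <= 1 by have := normr_mu d; lia.
by rewrite natz absz_nat (leq_trans (leq_mul mu1 (leqnn _))) // mul1n leq_div.
Qed.

Lemma wp_step1 s : regs s n_ = Posz n -> regs s I_ = Posz I ->
  wp W step1 (54 + 18 * k + 103 * D + 35 * prime_quotients D)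
    (fun s' => [/\ regs s' D_ = Posz D,
       forall j, j <= D -> mem s' MERT j = mertens j &
       regs s' S1_ = head_sum D.+1]) s.
Proof.
move=> n_E I_E.
have ev0 s' : eval W s' 0%expr = Some 0%R by exact: ev_cst.
have ev1 s' : eval W s' 1%expr = Some (Posz 1) by apply: ev_cst => /=; lia.
apply: (@wp_time _ _ ((17 + 18 * k) + ((12 + 36 * D + 10 * prime_quotients D) +
  ((10 + 33 * D + 25 * prime_quotients D) + (3 + ((2 + (3 + \sum_(1 <= i < D.+1) (3 + 9 + 4))) +
  (2 + ((2 + (3 + \sum_(1 <= i < D.+1) (3 + 11 + 4)))))))))) ).
  by rewrite !sum_nat_const_nat subn1; lia.
apply: wp_call.
  apply: (@wp_isqrt W D_ (n_ / I_)%expr (n %/ I) k s) => //.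
  - by apply: ev_div I0 _; [apply: ev_var n_E _ | apply: ev_var I_E _ |]; rewrite /=; lia.
  - by apply: leq_trans nW; rewrite leq_mul2l leq_exp2r //= ltnS leq_div.
  - by apply: leq_ltn_trans nk; apply: leq_div.
move=> s1 [fr1 _]; rewrite -/(sqrt_quot n I) -/D => D_E1.
apply: wp_call; first exact: (wp_eratosthenes D0 DW D_E1).
move=> s2 [fr2 _] COMP_E; have D_E2 : regs s2 D_ = Posz D by rewrite fr2.
apply: wp_seqA; apply: wp_call; first exact: (wp_mobius_sieve D0 DW D_E2 COMP_E).
move=> s3 [fr3 _] MU_E; have D_E3 : regs s3 D_ = Posz D by rewrite fr3.
apply: wp_seq; apply: (wp_put (ev0 _) (ev0 _)).
set s4 := set_mem _ _ _ _.
apply: wp_call.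
  apply: (@wp_for_up _ d_ _ _ _ 1 D (fun=> 9)
    (fun i s' => forall j, j < i -> mem s' MERT j = mertens j)) => //.
  - by lia.
  - by case=> // _; rewrite mertens0.
  - by move=> i s' _ [fr _] _; apply: ev_var; [rewrite fr | move=> /=; lia].
  move=> i s' /andP[i1 iD] [fr mfr] d_E IH.
  have ev_d : eval W s' d_ = Some (Posz i) by apply: ev_var d_E _ => /=; lia.
  apply: (wp_put (v := mertens i) ev_d); last first.
    move=> j ji /=; case: eqP => [-> //|/eqP nji].
    by apply: IH; lia.
  apply: (@ev_bin _ _ Add _ _ (mertens i.-1) (mu i)).
  - apply: (@ev_get _ _ _ _ (i - 1)).
    + by apply: (ev_sub ev_d (ev1 _)) => //; lia.
    + by rewrite IH ?subn1 // prednK.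
    + by have := absz_mertens i.-1; lia.
  - apply: (ev_get ev_d); last by have := normr_mu i; lia.
    by rewrite mfr // /s4 /= MU_E //; lia.
  - by case: i i1 {iD d_E IH ev_d} => // i _; rewrite /= mertensS.
  - by have := absz_mertens i; lia.
move=> s5 [fr5 mfr5] MERT_E.
apply: wp_seq; apply: (wp_assign (ev0 _)); set s6 := set_reg _ _ _.
apply: wp_conseq; last first.
  apply: (@wp_for_up _ d_ _ _ _ 1 D (fun=> 11) (fun i s' => regs s' S1_ = head_sum i)) => //.
  - by lia.
  - by rewrite /head_sum big_geq.
  - by move=> i s' _ [fr _] _; apply: ev_var; [rewrite fr // /s6 /= fr5 | move=> /=; lia].
  move=> i s' /andP[i1 iD] [fr mfr] d_E IH.
  have ev_d : eval W s' d_ = Some (Posz i) by apply: ev_var d_E _ => /=; lia.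
  have ii : i * i <= n by apply: leq_trans DDn; rewrite leq_mul.
  have small j : j <= i.+1 -> absz (head_sum j) <= W.
    move=> ji; apply: leq_trans (absz_head_sum j) _.
    apply: leq_trans nnW; nia.
  apply: (@wp_assign _ _ _ (head_sum i.+1)); last by [].
  have head_rec : head_sum i.+1 = (head_sum i + mu i * (n %/ (i * i))%N%:Z)%R.
    by rewrite /head_sum big_nat_recr //= -mulr_natr natz.
  apply: (@ev_bin _ _ Add _ _ (head_sum i) (mu i * (n %/ (i * i))%N%:Z)%R).
  - by apply: ev_var IH _; apply: small.
  - apply: (@ev_bin _ _ Mul _ _ (mu i) (n %/ (i * i))%N%:Z) => //.
    + apply: (ev_get ev_d); last by have := normr_mu i; lia.
      by rewrite mfr // /s6 /= mfr5 // /s4 /= MU_E //; lia.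
    + apply: ev_div; last lia; last by rewrite muln_gt0 i1.
        by apply: ev_var; [rewrite fr // /s6 /= fr5 // /s4 /= fr3 // fr2 // fr1 | move=> /=; lia].
      by apply: (ev_mul ev_d ev_d); lia.
    rewrite abszM absz_nat; have mu1 : absz (mu i) <= 1 by have := normr_mu i; lia.
    apply: leq_trans (leq_mul mu1 (leq_div n _)) _; lia.
  - by rewrite /= head_rec.
  - by apply: small.
move=> s7 [fr7 mfr7] S1_E; split=> //.
- by rewrite fr7 // /s6 /= fr5.
- by move=> j jD; rewrite mfr7 // MERT_E.
Qed.


Section Quotients.
Variable x : nat.
Let y := Nat.sqrt x.

(** Bounds the number of groups still to be visited from [d] on: those with
    [d <= y] are few because [d] increases, the others because [x %/ d <= y]
    decreases. *)
Definition groups_left d := if d <= y then y + (y.+1 - d) else x %/ d.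

Lemma divn_sqrt d : y < d -> x %/ d <= y.
Proof.
move=> yd; rewrite -ltnS ltn_divLR; last by apply: leq_trans yd.
have xy : x < y.+1 * y.+1 by rewrite ltnNge -leq_sqrt ltnn.
by rewrite (leq_trans xy) // leq_pmul2l.
Qed.

Lemma groups_left_leq d : 0 < d -> groups_left d <= 2 * y.
Proof.
move=> d0; rewrite /groups_left; have [dy|yd] := leqP d y; first by lia.
by have := divn_sqrt yd; lia.
Qed.

Lemma groups_left_next d : 0 < d <= x ->
  groups_left (x %/ (x %/ d)).+1 < groups_left d.
Proof.
move=> /andP[d0 dx]; have v0 : 0 < x %/ d by rewrite divn_gt0.
have de : d <= x %/ (x %/ d) by rewrite leq_divRL // mulnC -leq_divRL.
rewrite /groups_left; set e := x %/ (x %/ d) in de *.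
have [dy|yd] := leqP d y.
  have [ey|ye] := leqP e.+1 y; first by lia.
  by have := divn_sqrt ye; lia.
rewrite ifN -?ltnNge; last by lia.
rewrite ltn_divLR // mulnC; apply: contraTT (ltnSn e); rewrite -!leqNgt => h.
by rewrite /e leq_divRL.
Qed.

End Quotients.

Definition inner_loop : cmd :=
  While (d_ <= x_)
    (v_ ::= x_ / d_ ;;
     e_ ::= x_ / v_ ;;
     If (v_ <= D_)
       (m_ ::= MERT.[v_])
       (m_ ::= MX.[d_ * d_ * i_]) ;;
     s_ ::= s_ - (e_ - d_ + 1) * m_ ;;
     d_ ::= e_ + 1)%cmd.

(** The value of the register [s_] when the register [d_] contains [d]. *)
Definition recursion_sum x d : int := (1 - \sum_(2 <= j < d) mertens (x %/ j)%N)%R.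

Lemma recursion_sum_end x : 0 < x -> recursion_sum x x.+1 = mertens x.
Proof.
by move=> x0; rewrite /recursion_sum -(sum_mertens x0) big_ltn // divn1 addrK.
Qed.

Lemma absz_recursion_sum x d : absz (recursion_sum x d) <= 1 + d * x.
Proof.
have : absz (\sum_(2 <= j < d) mertens (x %/ j)%N)%R <= d * x.
  apply: (@leq_trans ((d - 2) * x)); last by rewrite leq_mul2r leq_subr orbT.
  by apply: absz_sum_nat => j _; apply: leq_trans (absz_mertens _) (leq_div _ _).
by rewrite /recursion_sum; set A := d * x; lia.
Qed.

Lemma recursion_sum_group x d : 0 < d <= x -> 1 < d ->
  let e := x %/ (x %/ d) in
  recursion_sum x e.+1 = (recursion_sum x d - (e - d + 1)%N%:Z * mertens (x %/ d)%N)%R.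
Proof.
move=> /andP[d0 dx] d1 e; have v0 : 0 < x %/ d by rewrite divn_gt0.
have de : d <= e by rewrite /e leq_divRL // mulnC -leq_divRL.
rewrite /recursion_sum (@big_cat_nat _ _ _ d 2 e.+1) //=; last by lia.
rewrite [X in (_ - (_ + X))%R](@eq_big_nat _ _ _ _ _ _ (fun=> mertens (x %/ d)%N)).
  by rewrite sumr_const_nat subSn // addn1 opprD addrA -mulr_natl natz.
by move=> j /andP[dj je]; rewrite (@divn_group x d j) // dj.
Qed.

(** One evaluation of the recursion takes [O(sqrt x_i)] operations by
    [groups_left_leq].  The entries of [MX] above [i] are enough because the
    index [d * d * i] is larger than [i] and, by [sqrt_quot_gt], below [I]. *)
Lemma wp_inner_loop i s : 0 < i < I ->
  regs s x_ = Posz (sqrt_quot n i) -> regs s i_ = Posz i -> regs s D_ = Posz D ->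
  regs s d_ = Posz 2 -> regs s s_ = Posz 1 ->
  (forall j, j <= D -> mem s MERT j = mertens j) ->
  (forall j, i < j < I -> mem s MX j = mertens (sqrt_quot n j)) ->
  wp W inner_loop (3 + (2 * Nat.sqrt (sqrt_quot n i)) * 35)
    (fun s' => regs s' s_ = mertens (sqrt_quot n i)) s.
Proof.
move=> /andP[i0 iI] x_E i_E D_E d_E s_E MERT_E MX_E.
set x := sqrt_quot n i in x_E *; have x0 : 0 < x by apply: sqrt_quot_gt0 => //; lia.
have xxn : x * x <= n by apply: sqrt_quot_sqr.
have xn : x <= n by apply: sqrt_quot_leq.
apply: (@wp_time _ _ (3 + (groups_left x 2) * 35)).
  by rewrite leq_add2l leq_mul2r groups_left_leq ?orbT.
apply: (@wp_while_count _ _ _ 32 (fun m s' => exists d,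
  [/\ regs s' d_ = Posz d, 1 < d <= x.+1, m = groups_left x d &
      regs s' s_ = recursion_sum x d])).
  by exists 2; split=> //; rewrite s_E /recursion_sum big_geq // subr0.
move=> m s' [fr mfr] [d [d'_E /andP[d1 dx] -> s'_E]].
have ev1 s1 : eval W s1 1%expr = Some (Posz 1) by apply: ev_cst => /=; lia.
have ev_d s1 : regs s1 d_ = Posz d -> eval W s1 d_ = Some (Posz d).
  by move=> E; apply: ev_var E _ => /=; lia.
have x'_E : regs s' x_ = Posz x by rewrite fr.
have ev_x s1 : regs s1 x_ = Posz x -> eval W s1 x_ = Some (Posz x).
  by move=> E; apply: ev_var E _ => /=; lia.
have -> := ev_le (ev_d _ d'_E) (ev_x _ x'_E).
case: (leqP d x) => [{}dx|xd]; [right|left]; split=> //; last first.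
  by rewrite s'_E (_ : d = x.+1) ?recursion_sum_end //; lia.
set v := x %/ d; set e := x %/ v.
have d0 : 0 < d by apply: ltnW.
have v0 : 0 < v by rewrite divn_gt0.
have vx : v <= x by apply: leq_div.
have de : d <= e by rewrite /e leq_divRL // mulnC -leq_divRL.
have ex : e <= x by apply: leq_div.
apply: (@wp_time _ _ (4 + (4 + ((3 + maxn 3 7) + (10 + 4))))) => //.
apply: wp_seq; apply: (@wp_assign _ _ _ (Posz v)).
  by apply: ev_div (ev_x _ x'_E) (ev_d _ d'_E) _ _ => //; lia.
set s1 := set_reg _ _ _.
have ev_v s2 : regs s2 v_ = Posz v -> eval W s2 v_ = Some (Posz v).
  by move=> E; apply: ev_var E _ => /=; lia.
apply: wp_seq; apply: (@wp_assign _ _ _ (Posz e)).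
  by apply: ev_div (ev_x s1 x'_E) (ev_v s1 _) _ _ => //; lia.
set s2 := set_reg _ _ _.
have ev_D : eval W s2 D_ = Some (Posz D) by apply: ev_var; [by rewrite /s2 /= fr | move=> /=; lia].
have mv_W : absz (mertens v) <= W by have := absz_mertens v; lia.
apply: (@wp_call _ _ _ _ _ (fun s3 => regs s3 m_ = mertens v)).
  apply: (wp_if (t1 := 3) (t2 := 7) (ev_le (ev_v s2 _) ev_D)) => //.
    move=> vD; apply: (@wp_assign _ _ _ (mertens v)) => //.
    by apply: (ev_get (ev_v s2 _)) => //; rewrite /s2 /= mfr // MERT_E.
  rewrite -ltnNge => Dv.
  (* The quotient is too large for the table: its Mertens value has been stored
     in [MX] by an earlier turn of the outer loop. *)
  have ddiI : d * d * i < I by apply: sqrt_quot_gt Dv.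
  have idd : i < d * d * i by rewrite -[X in X < _]mul1n ltn_pmul2r //; nia.
  have ddi : d * d <= d * d * i by rewrite leq_pmulr.
  apply: (@wp_assign _ _ _ (mertens v)) => //.
  apply: (@ev_get _ _ _ _ (d * d * i)) => //.
    apply: ev_mul; [|by apply: ev_var; [by rewrite /s2 /= fr |move=> /=; lia]|lia].
    by apply: (ev_mul (ev_d s2 _) (ev_d s2 _)) => //; lia.
  by rewrite /s2 /= mfr // MX_E ?idd //  -sqrt_quot_div.
move=> s3 [fr3 _] m_E.
have edW : (e - d + 1) * absz (mertens v) <= x * x.
  by apply: leq_mul; [lia | apply: leq_trans (absz_mertens v) vx].
have s_W j : j <= x.+1 -> absz (recursion_sum x j) <= W.
  move=> jx; apply: leq_trans (absz_recursion_sum x j) _; apply: leq_trans nnW; nia.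
have s3_E : regs s3 s_ = recursion_sum x d by rewrite fr3.
have ev_e s4 : regs s4 e_ = Posz e -> eval W s4 e_ = Some (Posz e).
  by move=> E; apply: ev_var E _ => /=; lia.
have e_E3 : regs s3 e_ = Posz e by rewrite fr3.
have d_E3 : regs s3 d_ = Posz d by rewrite fr3.
apply: wp_seq; apply: (@wp_assign _ _ _ (recursion_sum x e.+1)).
  apply: (@ev_bin _ _ Sub _ _ (recursion_sum x d) ((e - d + 1)%N%:Z * mertens v)%R).
  - by apply: ev_var s3_E _; apply: s_W; lia.
  - apply: (@ev_bin _ _ Mul _ _ (e - d + 1)%N%:Z (mertens v)) => //.
    + by apply: ev_add (ev1 _) _; [apply: (ev_sub (ev_e _ e_E3) (ev_d _ d_E3)) |]; lia.
    + by apply: ev_var m_E _.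
    by rewrite abszM absz_nat (leq_trans edW) //; lia.
  - by rewrite /= /e /v recursion_sum_group // d0.
  - by apply: s_W; lia.
set s4 := set_reg _ _ _.
apply: (@wp_assign _ _ _ (Posz (e + 1))).
  by apply: (ev_add (ev_e s4 _) (ev1 _)) => //; lia.
exists (groups_left x e.+1).
  by rewrite /e /v groups_left_next // d0.
exists e.+1; split=> //; first by rewrite /= addn1.
by lia.
Qed.

Lemma wp_step2 s :
  regs s n_ = Posz n -> regs s I_ = Posz I -> regs s D_ = Posz D ->
  (forall j, j <= D -> mem s MERT j = mertens j) ->
  wp W step2 (7 + \sum_(1 <= i < I) (34 + 18 * k + 70 * Nat.sqrt (sqrt_quot n i)))
    (fun s' => forall i, 0 < i < I -> mem s' MX i = mertens (sqrt_quot n i)) s.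
Proof.
move=> n_E I_E D_E MERT_E.
have ev1 s' : eval W s' 1%expr = Some (Posz 1) by apply: ev_cst => /=; lia.
pose tc i := (17 + 18 * k) + (2 + (2 + ((3 + (2 * Nat.sqrt (sqrt_quot n i)) * 35) + 3))).
apply: (@wp_time _ _ (4 + (3 + \sum_(1 <= i < (I - 1).+1) (3 + tc i + 4)))).
  rewrite subn1 prednK // addnA leq_add2l; apply: leq_sum => i _; rewrite /tc; lia.
apply: wp_conseq; last first.
  apply: (@wp_for_down _ i_ _ _ (I - 1) tc (fun i s' => forall j, i < j < I ->
      mem s' MX j = mertens (sqrt_quot n j))) => //.
  - by lia.
  - by apply: ev_sub (ev1 _) _ _; [apply: ev_var I_E _ => /= | |]; lia.
  - by move=> j; lia.
  move=> i s' /andP[i0 iI] [fr mfr] i_E IH.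
  have ev_n : eval W s' n_ = Some (Posz n) by apply: ev_var; [by rewrite fr | move=> /=; lia].
  have ev_i s1 : regs s1 i_ = Posz i -> eval W s1 i_ = Some (Posz i).
    by move=> E; apply: ev_var E _ => /=; lia.
  apply: wp_call.
    apply: (@wp_isqrt W x_ (n_ / i_)%expr (n %/ i) k s').
    - by apply: ev_div ev_n (ev_i _ i_E) _ _ => //; lia.
    - by apply: leq_trans nW; rewrite leq_mul2l leq_exp2r //= ltnS leq_div.
    - by apply: leq_ltn_trans nk; apply: leq_div.
  move=> s1 [fr1 mfr1] x_E.
  apply: wp_seq; apply: (wp_assign (ev1 _)).
  apply: wp_seq; apply: (@wp_assign _ _ _ (Posz 2)); first by apply: ev_cst => /=; lia.
  set s2 := set_reg _ _ _.
  apply: wp_call.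
    apply: (@wp_inner_loop i s2) => //.
    - by lia.
    - by rewrite /s2 /= fr1.
    - by rewrite /s2 /= fr1 // fr.
    - by move=> j jD; rewrite /s2 /= mfr1 // mfr // MERT_E.
    - by move=> j jI; rewrite /s2 /= mfr1 // IH.
  move=> s3 [fr3 mfr3] s_E.
  apply: (@wp_put _ _ _ _ i (mertens (sqrt_quot n i))).
  - by apply: ev_i; rewrite fr3 // /s2 /= fr1.
  - by apply: ev_var s_E _; have := absz_mertens (sqrt_quot n i); have := sqrt_quot_leq i; lia.
  move=> j ji /=; case: eqP => [-> //|/eqP nji].
  by rewrite mfr3 // /s2 /= mfr1 // IH //; lia.
by [].
Qed.

Lemma wp_step3 s :
  regs s I_ = Posz I -> regs s D_ = Posz D ->
  mem s MERT D = mertens D ->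
  (forall i, 0 < i < I -> mem s MX i = mertens (sqrt_quot n i)) ->
  wp W step3 (18 + 14 * I)
    (fun s' => regs s' S2_ =
       (\sum_(1 <= i < I) mertens (sqrt_quot n i) - mertens D *+ I.-1)%R) s.
Proof.
move=> I_E D_E MERT_E MX_E.
have ev1 s' : eval W s' 1%expr = Some (Posz 1) by apply: ev_cst => /=; lia.
have ev_I s' : regs s' I_ = Posz I -> eval W s' I_ = Some (Posz I).
  by move=> E; apply: ev_var E _ => /=; lia.
have ev_I1 s' : regs s' I_ = Posz I -> eval W s' (I_ - 1)%expr = Some (Posz (I - 1)).
  by move=> E; apply: ev_sub (ev_I _ E) (ev1 _) _ _; lia.
pose A j := (\sum_(1 <= i < j) mertens (sqrt_quot n i))%R.
have A_W j : j <= I -> absz (A j) <= n * n.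
  move=> jI; apply: (@leq_trans ((j - 1) * n)).
    by apply: absz_sum_nat => i _; apply: leq_trans (absz_mertens _) (sqrt_quot_leq i).
  by rewrite leq_mul2r; lia.
apply: (@wp_time _ _ (2 + ((2 + (5 + \sum_(1 <= i < (I - 1).+1) (5 + 5 + 4))) + 9))).
  rewrite sum_nat_const_nat; lia.
apply: wp_seq; apply: (@wp_assign _ _ _ 0%R); first exact: ev_cst.
set s1 := set_reg _ _ _.
apply: wp_call.
  apply: (@wp_for_up _ i_ _ _ _ 1 (I - 1) (fun=> 5) (fun i s' => regs s' S2_ = A i)) => //.
  - by lia.
  - by rewrite /A big_geq.
  - by move=> i s' _ [fr _] _; apply: ev_I1; rewrite fr.
  move=> i s' /andP[i0 iI] [_ mfr] i_E IH.
  apply: (@wp_assign _ _ _ (A i.+1)) => //.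
  apply: (@ev_bin _ _ Add _ _ (A i) (mertens (sqrt_quot n i))).
  - by apply: ev_var IH _; have := A_W i; lia.
  - apply: (@ev_get _ _ _ _ i); first by apply: ev_var i_E _ => /=; lia.
      by rewrite mfr // /s1 /= MX_E //; lia.
    by have := absz_mertens (sqrt_quot n i); have := sqrt_quot_leq i; lia.
  - by rewrite /= /A big_nat_recr.
  - by apply: leq_trans (A_W i.+1 _) _; lia.
move=> s2 [fr2 mfr2] S2_E.
have I2_E : regs s2 I_ = Posz I by rewrite fr2.
have -> : I.-1 = I - 1 by lia.
have AI : A (I - 1).+1 = A I by congr A; lia.
apply: (@wp_assign _ _ _ (A I - mertens D *+ (I - 1))%R) => //.
have dW : absz (mertens D *+ (I - 1))%R <= n * n.
  rewrite -mulr_natr natz abszM absz_nat; apply: leq_mul; last by lia.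
  by apply: leq_trans (absz_mertens D) Dn.
have AW : absz (A I) <= n * n by exact: A_W.
apply: (@ev_bin _ _ Sub _ _ (A I) (mertens D *+ (I - 1))%R) => //.
- by apply: ev_var; [rewrite S2_E AI | lia].
- apply: (@ev_bin _ _ Mul _ _ (I - 1)%N%:Z (mertens D)) => //.
  + exact: ev_I1.
  + apply: (@ev_get _ _ _ _ D).
    * by apply: ev_var; [by rewrite fr2 | move=> /=; lia].
    * by rewrite mfr2.
    * by have := absz_mertens D; lia.
  + by rewrite /= -mulr_natl natz.
  + by lia.
- have : 4 * n.+1 ^ 2 = 4 * (n * n) + 8 * n + 4 by rewrite -mulnn; lia.
  by lia.
Qed.


(** The four summands are the size of the table, the visits of the sieves, the
    bisections (one for each [i], of [k] turns) and the groups of the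
    recursions; all constants are absorbed by 120. *)
Lemma algA_correct : exists2 t, algA_runs W n I t (Posz (nb_squarefree n)) &
  t <= 120 * (D + prime_quotients D + I * k + \sum_(1 <= i < I) Nat.sqrt (sqrt_quot n i)).
Proof.
pose N1 := 54 + 18 * k + 103 * D + 35 * prime_quotients D.
pose N2 := 7 + \sum_(1 <= i < I) (34 + 18 * k + 70 * Nat.sqrt (sqrt_quot n i)).
have k0 : 0 < k by case: (k) nk => // n1; lia.
suff [t [s [ex tN S_E]]] : wp W algA (N1 + (N2 + (18 + 14 * I + 4)))
    (fun s => regs s S_ = Posz (nb_squarefree n)) (input n I).
  exists t; first by exists s.
  apply: leq_trans tN _; rewrite /N1 /N2 big_split /= sum_nat_const_nat -big_distrr /=.
  have : k + I <= (I * k).+1 by nia.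
  have : (I - 1) * (34 + 18 * k) + 34 + 18 * k = I * 34 + 18 * (I * k) by nia.
  by lia.
have n_E : regs (input n I) n_ = Posz n by [].
apply: wp_call; first exact: wp_step1.
move=> s1 [fr1 _] [D_E1 MERT_E1 S1_E1].
have n_E1 : regs s1 n_ = Posz n by rewrite fr1.
have I_E1 : regs s1 I_ = Posz I by rewrite fr1.
apply: wp_call; first exact: wp_step2.
move=> s2 [fr2 mfr2] MX_E2.
have I_E2 : regs s2 I_ = Posz I by rewrite fr2.
have D_E2 : regs s2 D_ = Posz D by rewrite fr2.
apply: wp_call; first by apply: wp_step3 => //; rewrite mfr2 // MERT_E1.
move=> s3 [fr3 _] S2_E3.
have S_E : (regs s3 S1_ + regs s3 S2_)%R = Posz (nb_squarefree n).
  by rewrite fr3 // fr2 // S1_E1 S2_E3 (nb_squarefree_split n I0).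
have sfn : nb_squarefree n <= n.
  rewrite /nb_squarefree big_mkcond /=; apply: (@leq_trans (\sum_(1 <= m < n.+1) 1)).
    by apply: leq_sum => m _; case: ifP.
  by rewrite sum_nat_const_nat muln1 subn1.
have S1W : absz (regs s3 S1_) <= n * n + n.
  rewrite fr3 // fr2 // S1_E1; apply: leq_trans (absz_head_sum _) _.
  by rewrite mulSn addnC leq_add2r leq_mul2r Dn orbT.
apply: (@wp_assign _ _ _ (Posz (nb_squarefree n))) => //.
apply: (@ev_bin _ _ Add _ _ (regs s3 S1_) (regs s3 S2_)).
- by apply: ev_var => //; lia.
- by apply: ev_var => //; lia.
- by rewrite /= S_E.
- by rewrite absz_nat; lia.
Qed.

End Algorithm.

Local Open Scope ring_scope.

(** * Balancing the costs *)

Section Estimates.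
Context (R : realType).

Definition root4 (m : nat) : R := Num.sqrt (Num.sqrt m%:R).

Lemma root4_ge0 m : 0 <= root4 m. Proof. exact: sqrtr_ge0. Qed.

Lemma root4X m : root4 m ^+ 4 = m%:R.
Proof. by rewrite -[4%N]/(2 * 2)%N exprM !sqr_sqrtr ?sqrtr_ge0. Qed.

Lemma root4_gt0 m : (0 < m)%N -> 0 < root4 m.
Proof. by move=> m0; rewrite !sqrtr_gt0 ltr0n. Qed.

Lemma le_of_sqr (x y : R) : 0 <= y -> x ^+ 2 <= y ^+ 2 -> x <= y.
Proof. by move=> y0 h; have [|yx] := leP x y => //; nra. Qed.

Lemma le_of_exp4 (x y : R) : 0 <= y -> x ^+ 4 <= y ^+ 4 -> x <= y.
Proof.
move=> y0 h; apply: le_of_sqr => //; apply: le_of_sqr; first exact: sqr_ge0.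
by rewrite -!exprM.
Qed.

(** The sum is bounded by the integral of [t ^ (- 1 / 4)].  With [u] and [v] the
    fourth roots of [m] and [m + 1], the induction step amounts to
    [0 <= v ^ 4 - 4 * v * u ^ 3 + 3 * u ^ 4], which factors as below. *)
Lemma sum_inv_root4 m : \sum_(1 <= i < m.+1) (root4 i)^-1 <= 4 / 3 * root4 m ^+ 3.
Proof.
elim: m => [|m IH].
  by rewrite big_geq // mulr_ge0 ?exprn_ge0 ?root4_ge0.
rewrite big_nat_recr //=; apply: le_trans (lerD IH (lexx _)) _.
have v4 := root4X m.+1; rewrite -natr1 -root4X in v4.
have u0 := root4_ge0 m; have v0 : 0 < root4 m.+1 by exact: root4_gt0.
set u := root4 m in u0 v4 *; set v := root4 m.+1 in v0 v4 *.
have vv : v * v^-1 = 1 by rewrite divff ?lt0r_neq0.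
rewrite -(ler_pM2l v0) mulrDr vv.
have : 0 <= (v - u) ^+ 2 * (v ^+ 2 + 2 * u * v + 3 * u ^+ 2).
  by rewrite mulr_ge0 ?sqr_ge0 // !addr_ge0 ?mulr_ge0 ?sqr_ge0 // ltW.
have -> : (v - u) ^+ 2 * (v ^+ 2 + 2 * u * v + 3 * u ^+ 2) =
  v ^+ 4 - 4 * v * u ^+ 3 + 3 * u ^+ 4 by ring.
have -> : v * (4 / 3 * v ^+ 3) = 4 / 3 * v ^+ 4 by ring.
by rewrite v4; lra.
Qed.

Section Balance.
(** Writing [n = a ^ 20] and [b ^ 5] for the iterated logarithm of [n], the
    prescribed parameter is [a ^ 4 * b ^ 4], the claimed running time is
    [a ^ 8 * b ^ 3], and all estimates become inequalities between monomials;
    [l] stands for the logarithm of [n] and [k] for its length in bits. *)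
Variables (a b l : R) (n I k : nat).
Hypotheses (a2 : 2 <= a) (b1 : 1 <= b) (na : n%:R = a ^+ 20) (bl : b ^+ 5 <= l).
Hypotheses (la : l <= 10 * a ^+ 2) (hI : `|I%:R - a ^+ 4 * b ^+ 4| < 1).
Hypotheses (I0 : (0 < I)%N) (nk : (n < 2 ^ k)%N).
Hypotheses (kl : k%:R <= 3 * l) (lnk : ln k%:R <= 3 * b ^+ 5).

Let a0 : 0 < a. Proof. by apply: lt_le_trans a2. Qed.
Let b0 : 0 < b. Proof. by apply: lt_le_trans b1. Qed.

Let r_ge2 : 2 <= a ^+ 4 * b ^+ 4.
Proof.
have a16 : 2 <= a ^+ 4.
  by apply: le_trans a2 _; rewrite ler_eXnr //; apply: le_trans a2; lra.
have b4 : 1 <= b ^+ 4 by apply: exprn_ege1.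
by nra.
Qed.

Let I_le : I%:R <= 2 * (a ^+ 4 * b ^+ 4).
Proof. by move: hI r_ge2; rewrite ltr_norml => /andP[h1 h2]; lra. Qed.

Let I_ge : a ^+ 4 * b ^+ 4 <= 2 * I%:R.
Proof. by move: hI r_ge2; rewrite ltr_norml => /andP[h1 h2]; lra. Qed.

Lemma parameter_le : (I <= n)%N.
Proof.
rewrite -(ler_nat R) na; apply: le_trans I_le _.
have b4 : b ^+ 4 <= 10 * a ^+ 2.
  by apply: le_trans la; apply: le_trans bl; rewrite ler_weXn2l.
have a4 : 0 < a ^+ 4 by exact: exprn_gt0.
apply: (@le_trans _ _ (20 * a ^+ 6)).
  have -> : 20 * a ^+ 6 = 2 * (a ^+ 4 * (10 * a ^+ 2)) by ring.
  by rewrite ler_pM2l // ler_pM2l.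
rewrite -[20%N]/(14 + 6)%N exprD ler_pM2r ?exprn_gt0 //.
apply: (@le_trans _ _ (2 ^+ 14)); first by lra.
by rewrite lerXn2r ?nnegrE // ltW.
Qed.

(** From [D ^ 2 * I <= n = a ^ 20] and [I >= a ^ 4 * b ^ 4 / 2]. *)
Lemma table_size_le : (sqrt_quot n I)%:R * b ^+ 2 <= 2 * a ^+ 8.
Proof.
apply: le_of_sqr; first by rewrite mulr_ge0 // exprn_ge0 // ltW.
have DDI : (sqrt_quot n I)%:R ^+ 2 * I%:R <= a ^+ 20 :> R.
  by rewrite -na -natrX -natrM ler_nat -mulnn -leq_divRL // -leq_sqrt.
have D0 : 0 <= (sqrt_quot n I)%:R ^+ 2 :> R by exact: sqr_ge0.
have := ler_wpM2l D0 I_ge; set d := (sqrt_quot n I)%:R in DDI D0 *.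
have a4 : 0 < a ^+ 4 by exact: exprn_gt0.
move=> h; rewrite -(ler_pM2l a4).
have -> : a ^+ 4 * (2 * a ^+ 8) ^+ 2 = 4 * a ^+ 20 by ring.
have -> : a ^+ 4 * (d * b ^+ 2) ^+ 2 = d ^+ 2 * (a ^+ 4 * b ^+ 4) by ring.
have A : 0 <= a ^+ 20 by rewrite exprn_ge0 // ltW.
nra.
Qed.

(** The sieves cost [D] times the iterated logarithm, and the factor [b ^ 5] is
    reduced to [b ^ 3] by the factor [b ^ 2] of [table_size_le]. *)
Lemma sieve_cost_le :
  (sqrt_quot n I)%:R + (prime_quotients (sqrt_quot n I))%:R <= 20 * (a ^+ 8 * b ^+ 3).
Proof.
have k0 : (0 < k)%N.
  rewrite lt0n; apply: contraTneq nk => ->.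
  by rewrite expn0 ltnS -ltnNge (leq_trans I0 parameter_le).
have Dk : (sqrt_quot n I < 2 ^ k)%N by apply: leq_ltn_trans nk; exact: sqrt_quot_leq.
have := @prime_quotients_le R _ _ k0 Dk.
have := table_size_le; set d := (sqrt_quot n I)%:R => h1 h2.
have d0 : 0 <= d by exact: ler0n.
have b5 : 1 <= b ^+ 5 by apply: exprn_ege1.
have h3 : d * (5 / 2 + 2 * ln k%:R) <= d * (10 * b ^+ 5 - 1).
  by apply: ler_wpM2l => //; move: lnk; lra.
have -> : 20 * (a ^+ 8 * b ^+ 3) = 10 * b ^+ 3 * (2 * a ^+ 8) by ring.
have h4 : 10 * b ^+ 3 * (d * b ^+ 2) <= 10 * b ^+ 3 * (2 * a ^+ 8).
  by apply: ler_wpM2l => //; rewrite mulr_ge0 // exprn_ge0 // ltW.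
apply: le_trans h4.
have -> : 10 * b ^+ 3 * (d * b ^+ 2) = d * (10 * b ^+ 5) by ring.
lra.
Qed.

(** There is room to spare: this is about [n ^ (1 / 5)] up to logarithms. *)
Lemma isqrt_cost_le : I%:R * k%:R <= 600 * (a ^+ 8 * b ^+ 3).
Proof.
have l1 : 1 <= l by apply: le_trans bl; apply: exprn_ege1.
have bl1 : b <= l by apply: le_trans bl; rewrite ler_eXnr.
apply: (@le_trans _ _ (2 * (a ^+ 4 * b ^+ 4) * (3 * l))).
  by apply: ler_pM.
have -> : 2 * (a ^+ 4 * b ^+ 4) * (3 * l) = 6 * (a ^+ 4 * b ^+ 3) * (b * l) by ring.
have -> : 600 * (a ^+ 8 * b ^+ 3) = 6 * (a ^+ 4 * b ^+ 3) * ((10 * a ^+ 2) * (10 * a ^+ 2)) by ring.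
apply: ler_wpM2l; first by rewrite !mulr_ge0 ?exprn_ge0 // ltW.
by apply: ler_pM => //; [exact: ltW | lra | apply: le_trans la].
Qed.

(** With [y_i = floor (sqrt x_i)], [y_i ^ 4 * i <= n] bounds [y_i] by [a ^ 5]
    times the inverse fourth root of [i]; then sum over [i]. *)
Lemma recursion_cost_le :
  (\sum_(1 <= i < I) Nat.sqrt (sqrt_quot n i))%:R <= 11 * (a ^+ 8 * b ^+ 3).
Proof.
apply: (@le_trans _ _ (\sum_(1 <= i < I) a ^+ 5 * (root4 i)^-1)).
  rewrite natr_sum big_nat_cond [X in _ <= X]big_nat_cond; apply: ler_sum => i.
  rewrite andbT => /andP[i0 iI].
  rewrite ler_pdivlMr ?root4_gt0 //; apply: le_of_exp4.
    by rewrite exprn_ge0 // ltW.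
  rewrite exprMn root4X -exprM -na -natrX -natrM ler_nat.
  have ys : (Nat.sqrt (sqrt_quot n i) ^ 2 <= sqrt_quot n i)%N by rewrite -mulnn -leq_sqrt.
  have xn : (sqrt_quot n i ^ 2 * i <= n)%N by rewrite -mulnn -leq_divRL // -leq_sqrt.
  apply: leq_trans xn; rewrite leq_mul2r -[4%N]/(2 * 2)%N expnM leq_exp2r //.
  by rewrite ys orbT.
rewrite -mulr_sumr.
have rI : root4 I <= 2 * a * b.
  apply: le_of_exp4; first by rewrite !mulr_ge0 // ltW.
  rewrite root4X; apply: le_trans I_le _.
  have -> : (2 * a * b) ^+ 4 = 16 * (a ^+ 4 * b ^+ 4) by ring.
  by move: r_ge2; lra.
have h : \sum_(1 <= i < I) (root4 i)^-1 <= 4 / 3 * (2 * a * b) ^+ 3.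
  apply: (@le_trans _ _ (4 / 3 * root4 I ^+ 3)).
    apply: le_trans (sum_inv_root4 I); rewrite big_nat_recr //= lerDl.
    by rewrite invr_ge0 root4_ge0.
  by rewrite ler_wpM2l //; last rewrite lerXn2r ?nnegrE ?root4_ge0 // !mulr_ge0 // ltW.
apply: (@le_trans _ _ (a ^+ 5 * (4 / 3 * (2 * a * b) ^+ 3))).
  by rewrite ler_wpM2l // exprn_ge0 // ltW.
have -> : a ^+ 5 * (4 / 3 * (2 * a * b) ^+ 3) = 32 / 3 * (a ^+ 8 * b ^+ 3) by ring.
rewrite ler_wpM2r //; last by lra.
by rewrite mulr_ge0 // exprn_ge0 // ltW.
Qed.

End Balance.
End Estimates.

Local Open Scope classical_set_scope.

(** * Asymptotics *)

Section Growth.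
Context (R : realType).

Lemma powR_frac (x p q : R) m : p * m%:R = q -> (x `^ p) ^+ m = x `^ q.
Proof. by move=> <-; rewrite -powR_mulrn ?powR_ge0 // powRrM. Qed.

Lemma ln2_ge : 2^-1 <= ln 2 :> R.
Proof.
have -> : 2 = (1 + - 2^-1)^-1 :> R by field.
rewrite lnV ?posrE; last by lra.
by have := @le_ln1Dx R (- 2^-1); lra.
Qed.

Section Large.
Variable n : nat.
Let x : R := n%:R.
Let l := ln x.
Let L := loglog R n.
Let a := x `^ (1 / 20).
Let b := L `^ (1 / 5).
(** The first bound makes the iterated logarithm, hence [b], at least 1; the
    second one makes [a] at least 2. *)
Hypothesis x_e : expR (expR 1) <= x.
Hypothesis x_2 : 2 ^+ 20 <= x.

Let x0 : 0 < x. Proof. by apply: lt_le_trans x_2; rewrite exprn_gt0. Qed.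

Let l_e : expR 1 <= l.
Proof. by rewrite -[X in X <= _]expRK ler_ln ?posrE ?expR_gt0. Qed.

Let l1 : 1 <= l.
Proof. by apply: le_trans l_e; have := @expR_ge1Dx R 1; lra. Qed.

Let l0 : 0 < l. Proof. exact: lt_le_trans l1. Qed.

Let L1 : 1 <= L.
Proof. by rewrite -[X in X <= _]expRK /L /loglog ler_ln ?posrE ?expR_gt0. Qed.

Let L0 : 0 <= L. Proof. exact: le_trans L1. Qed.

Lemma large_a2 : 2 <= a.
Proof.
have -> : 2 = (2 ^+ 20) `^ (1 / 20) :> R.
  by rewrite -powR_mulrn // -powRrM (_ : 20%:R * (1 / 20) = 1) ?powRr1 //; field.
by rewrite ge0_ler_powR ?nnegrE ?exprn_ge0 // ltW.
Qed.

Lemma large_b1 : 1 <= b.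
Proof.
have -> : 1 = 1 `^ (1 / 5) :> R by rewrite powR1.
by rewrite ge0_ler_powR ?nnegrE.
Qed.


Lemma large_a20 : n%:R = a ^+ 20.
Proof. by rewrite (@powR_frac x _ 1) ?powRr1 ?(ltW x0) //; field. Qed.

Lemma large_b5 : b ^+ 5 = L.
Proof. by rewrite (@powR_frac L _ 1) ?powRr1 //; field. Qed.

Lemma large_Ll : b ^+ 5 <= l.
Proof. by rewrite large_b5 ltW // ln_sublinear. Qed.

(** [ln (a ^ 2) = l / 10] and the logarithm is sublinear. *)
Lemma large_la : l <= 10 * a ^+ 2.
Proof.
have a2 : 0 < a ^+ 2 by rewrite exprn_gt0 // powR_gt0.
have := ln_sublinear a2; rewrite lnXn ?powR_gt0 // ln_powR -/l -mulr_natr; lra.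
Qed.

Lemma large_r : x `^ (1 / 5) * L `^ (4 / 5) = a ^+ 4 * b ^+ 4.
Proof. by rewrite (@powR_frac x _ (1 / 5)) ?(@powR_frac L _ (4 / 5)) //; field. Qed.

Lemma large_bound : x `^ (2 / 5) * L `^ (3 / 5) = a ^+ 8 * b ^+ 3.
Proof. by rewrite (@powR_frac x _ (2 / 5)) ?(@powR_frac L _ (3 / 5)) //; field. Qed.

Let k := (trunc_log 2 n).+1.

Lemma large_nk : (n < 2 ^ k)%N.
Proof. exact: trunc_log_ltn. Qed.

Lemma large_kl : k%:R <= 3 * l.
Proof.
have n0 : (0 < n)%N by rewrite -(ltr_nat R).
have : (2 ^ trunc_log 2 n)%:R <= x :> R by rewrite ler_nat trunc_logP.
rewrite -ler_ln ?posrE ?ltr0n ?expn_gt0 // natrX lnXn // -(mulr_natr (ln 2)) -/l => h.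
have := ler_wpM2r (ler0n R (trunc_log 2 n)) ln2_ge.
by rewrite /k -(natr1 (trunc_log 2 n)); move: l1 h; lra.
Qed.

Lemma large_lnk : ln k%:R <= 3 * b ^+ 5.
Proof.
rewrite large_b5; apply: (@le_trans _ _ (ln (3 * l))).
  by rewrite ler_ln ?posrE ?ltr0n ?mulr_gt0 // large_kl.
rewrite lnM ?posrE //.
have ln3 : ln 3 <= 2 :> R.
  by have := @le_ln1Dx R 2; rewrite (_ : 1 + 2 = 3) => [|]; [apply; lra | ring].
have -> : ln l = L by [].
by move: L1; lra.
Qed.

(** Words of size [n ^ 4] can hold all intermediate values. *)
Lemma large_words : (4 * n.+1 ^ 2 <= n ^ 4)%N.
Proof.
have n4 : (4 <= n)%N.
  rewrite -(ler_nat R); apply: le_trans x_2.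
  by rewrite -[20%N]/(2 + 18)%N exprD -[X in X <= _]mulr1 ler_pM ?exprn_ge1 //; lra.
rewrite -[4%N in X in (_ <= X)%N]/(2 * 2)%N expnM -!mulnn; nia.
Qed.

Lemma algA_cost I (hI : rounds_to (x `^ (1 / 5) * L `^ (4 / 5)) I) :
  exists2 t, algA_runs (n ^ 4) n I t (Posz (nb_squarefree n)) &
    t%:R <= 120 * 631 * (x `^ (2 / 5) * L `^ (3 / 5)).
Proof.
case: hI => I0; rewrite large_r large_bound => hI.
have I_n := parameter_le large_a2 large_b1 large_a20 large_Ll large_la hI.
have [t runs t_le] := algA_correct I0 I_n large_words large_nk.
exists t => //; move: t_le; rewrite -(ler_nat R) => /le_trans; apply.
(* 631 is the sum of the constants of the three estimates. *)
have h1 := sieve_cost_le large_a2 large_b1 large_a20 large_Ll large_la hI I0 large_nk large_lnk.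
have h2 := isqrt_cost_le large_a2 large_b1 large_Ll large_la hI large_kl.
have h3 := recursion_cost_le large_a2 large_b1 large_a20 hI.
rewrite -mulrA; have -> : 631 * (a ^+ 8 * b ^+ 3) =
  20 * (a ^+ 8 * b ^+ 3) + 600 * (a ^+ 8 * b ^+ 3) + 11 * (a ^+ 8 * b ^+ 3) by ring.
rewrite natrM ler_wpM2l // !natrD (natrM _ I k).
apply: lerD; last exact: h3.
by apply: lerD; [exact: h1 | exact: h2].
Qed.

Lemma large_bound_le : x `^ (2 / 5) * L `^ (3 / 5) <= x `^ (2 / 5) * l.
Proof.
rewrite ler_wpM2l ?powR_ge0 // -(@powR_frac L (1 / 5) (3 / 5) 3) -/b; last by field.
by apply: le_trans large_Ll; rewrite ler_weXn2l // large_b1.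
Qed.

Lemma large_parameter_le I : rounds_to (x `^ (1 / 5) * L `^ (4 / 5)) I ->
  I%:R <= 2 * (x `^ (1 / 5) * l).
Proof.
case=> _; rewrite ltr_norml => /andP[_ hI].
have r1 : 1 <= x `^ (1 / 5) * L `^ (4 / 5).
  by rewrite large_r mulr_ege1 // exprn_ege1 // ?large_b1 // (le_trans _ large_a2) // ler1n.
have : x `^ (1 / 5) * L `^ (4 / 5) <= x `^ (1 / 5) * l.
  rewrite ler_wpM2l ?powR_ge0 // -(@powR_frac L (1 / 5) (4 / 5) 4) -/b; last by field.
  by apply: le_trans large_Ll; rewrite ler_weXn2l // large_b1.
lra.
Qed.

End Large.

Lemma bigO_near (f g : nat -> R^o) (C : R) :
  (\forall n \near \oo, `|f n| <= C * `|g n|) -> f =O_\oo g.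
Proof.
move=> H; apply/eqO_exP; exists (Num.max 1 C); first by rewrite lt_max ltr01.
near=> n; have h : `|f n| <= C * `|g n| by near: n.
by apply: le_trans h _; rewrite ler_wpM2r // le_max lexx orbT.
Unshelve. all: by end_near. Qed.

End Growth.

Unset Implicit Arguments.

Theorem theorem3 (R : realType) (Ipar : nat -> nat)
    (hI : \forall n \near \oo,
       rounds_to (n%:R `^ (1 / 5) * loglog R n `^ (4 / 5)) (Ipar n)) :
  exists (c : nat) (T : nat -> nat),
    [/\ \forall n \near \oo,
          algA_runs (n ^ c)%N n (Ipar n) (T n) (Posz (nb_squarefree n)),
        (fun n => (T n)%:R : R^o) =O_\oo
          (fun n => n%:R `^ (2 / 5) * loglog R n `^ (3 / 5) : R^o),
        softO (fun n => n%:R `^ (2 / 5) * loglog R n `^ (3 / 5))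
              (fun n => n%:R `^ (2 / 5)),
        softO (fun n => (T n)%:R : R) (fun n => n%:R `^ (2 / 5)) &
        softO (fun n => (Ipar n)%:R : R) (fun n => n%:R `^ (1 / 5))].
Proof.
pose good n := [/\ expR (expR 1) <= n%:R :> R, 2 ^+ 20 <= n%:R :> R &
  rounds_to (n%:R `^ (1 / 5) * loglog R n `^ (4 / 5)) (Ipar n)].
have good_near : \forall n \near \oo, good n.
  near=> n; split; last by near: n.
  - by near: n; apply: nbhs_infty_ger.
  - by near: n; apply: nbhs_infty_ger.
(* Outside of the good [n] any value of [T] will do. *)
have /choice[T T_spec] : forall n, exists t, good n ->
    algA_runs (n ^ 4)%N n (Ipar n) t (Posz (nb_squarefree n)) /\
    t%:R <= 120 * 631 * (n%:R `^ (2 / 5) * loglog R n `^ (3 / 5)).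
  move=> n; have [[x_e x_2 r]|bad] := pselect (good n); last by exists 0%N.
  have [t runs t_le] := algA_cost x_e x_2 r.
  by exists t => _; split.
exists 4%N, T; split.
- by near=> n; apply: (proj1 (T_spec n _)); near: n.
- apply: (@bigO_near _ _ _ (120 * 631)); near=> n.
  have gn : good n by near: n.
  rewrite !ger0_norm ?ler0n ?mulr_ge0 ?powR_ge0 //.
  by have [] := T_spec n gn.
- exists 1%N; apply: (@bigO_near _ _ _ 1); near=> n.
  have [x_e x_2 _] : good n by near: n.
  have h := large_bound_le x_e x_2.
  rewrite expr1 mul1r !ger0_norm ?mulr_ge0 ?powR_ge0 //.
  by rewrite ln_ge0 // (le_trans _ x_2) // exprn_ege1 // ler1n.
- exists 1%N; apply: (@bigO_near _ _ _ (120 * 631)); near=> n.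
  have gn : good n by near: n.
  have [x_e x_2 _] := gn; have h := large_bound_le x_e x_2.
  rewrite expr1 !ger0_norm ?ler0n ?mulr_ge0 ?powR_ge0 //.
    have [_ T_le] := T_spec n gn; apply: le_trans T_le _.
    exact: ler_wpM2l (mulr_ge0 (ler0n _ _) (ler0n _ _)) _ _ h.
  by rewrite ln_ge0 // (le_trans _ x_2) // exprn_ege1 // ler1n.
- exists 1%N; apply: (@bigO_near _ _ _ 2); near=> n.
  have [x_e x_2 r] : good n by near: n.
  have h := large_parameter_le x_e x_2 r.
  rewrite expr1 !ger0_norm ?ler0n ?mulr_ge0 ?powR_ge0 //.
  by rewrite ln_ge0 // (le_trans _ x_2) // exprn_ege1 // ler1n.
Unshelve. all: by end_near. Qed.
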